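(* Let $\sigma>0$, $\rho>0$, $\alpha>0$, $m=\lceil\alpha\rceil$, $K>0$, $h^*>0$, $b_0,\dots,b_{m-1}\in\mathbb{R}$, and $$ H=\Big\{(t,y)\in\mathbb{R}^2: 0\le t\le h^*,\ \Big|y-e^{-\sigma t^\rho}\sum_{k=0}^{m-1}\frac{b_k}{\Gamma(k+1)}t^{\rho k}\Big|\le K\Big\}. $$ Let $f:H\to\mathbb{R}$ be continuous and bounded, and suppose there is $L>0$ with $|f(t,y)-f(t,\tilde y)|\le L|y-\tilde y|$ for all $(t,y),(t,\tilde y)\in H$. Let $\tilde\alpha>\alpha$, $\tilde m=\lceil\tilde\alpha\rceil$, and (if $\tilde m>m$) let $b_m,\dots,b_{\tilde m-1}\in\mathbb{R}$. Let $\psi$ be the solution of $$ {}_\sigma^c D_0^{\alpha,\rho}\psi(t)=f(t,\psi(t))\ (t>0),\qquad {}_\sigma D^{k,\rho}\psi(0)=b_k,\quad k\in\{0,\dots,m-1\}, $$ and let $\phi$ be the solution of $$ {}_\sigma^c D_0^{\tilde\alpha,\rho}\phi(t)=f(t,\phi(t))\ (t>0),\qquad {}_\sigma D^{k,\rho}\phi(0)=b_k,\quad k\in\{0,\dots,\tilde m-1\}. $$ Let $\epsilon=\tilde\alpha-\alpha$, and let $\tilde\epsilon=0$ if $\tilde m=m$ and $\tilde\epsilon=\max\{|b_k|: m\le k\le\tilde m-1\}$ otherwise. If $\epsilon$ and $\tilde\epsilon$ are sufficiently small, then there is a constant $h>0$ such that $\psi$ and $\phi$ are defined on $[0,h]$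 and $$ \sup_{0\le t\le h}|\psi(t)-\phi(t)|=\mathcal{O}(\epsilon)+\mathcal{O}(\tilde\epsilon). $$ That is, there are constants $\epsilon_0,h,C>0$, not depending on $\tilde\alpha$ nor on $b_k$ for $k\ge m$, such that whenever $\epsilon\le\epsilon_0$ and $\tilde\epsilon\le\epsilon_0$ both solutions are defined on $[0,h]$ and $\sup_{0\le t\le h}|\psi(t)-\phi(t)|\le C(\epsilon+\tilde\epsilon)$.
   Context: Differential operator: ${}_\sigma D^{n,\rho}=\big(\frac{t^{1-\rho}}{\rho}\frac{d}{dt}+\sigma\big)^n$ ($n$-fold composition, ${}_\sigma D^{0,\rho}$ the identity); ${}_\sigma D^{k,\rho}\psi(0)$ denotes its value at $0$, understood as the limit as $t\to0^+$. Generalized substantial operators with lower limit $0$: for $\gamma>0$, ${}_\sigma I_0^{\gamma,\rho}\psi(t)=\frac{\rho}{\Gamma(\gamma)}\int_0^t (t^\rho-s^\rho)^{\gamma-1}e^{-\sigma(t^\rho-s^\rho)}s^{\rho-1}\psi(s)\,ds$, ${}_\sigma I_0^{0,\rho}$ is the identity, and for any order $\gamma>0$ with $n=\lceil\gamma\rceil$, ${}_\sigma D_0^{\gamma,\rho}\psi={}_\sigma D^{n,\rho}\,{}_\sigma I_0^{n-\gamma,\rho}\psi$. The generalized Caputo type substantial derivative of order $\gamma$ is $$ {}_\sigma^c D_0^{\gamma,\rho}\psi(t)={}_\sigma D_0^{\gamma,\rho}\Big(\psi(t)-\sum_{k=0}^{n-1}\frac{{}_\sigma D^{k,\rho}\psi(0)}{k!}\,t^{\rho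 k}e^{-\sigma t^\rho}\Big). $$ A solution of such an initial value problem on $[0,h]$ is a function in $C[0,h]$ with graph contained in $H$, for which the expressions in the problem exist, satisfying the differential equation for $0<t\le h$ and the initial conditions; ''the solution is defined on $[0,h]$'' means that a unique such solution on $[0,h]$ exists. *)

(* Defs.v *)
From HB Require Import structures.
From mathcomp Require Import all_boot all_order all_algebra.
From mathcomp Require Import all_classical all_reals all_analysis.

Set Implicit Arguments.
Unset Strict Implicit.
Unset Printing Implicit Defensive.

Import Order.TTheory GRing.Theory Num.Theory.
Import numFieldNormedType.Exports.

Local Open Scope classical_set_scope.
Local Open Scope ring_scope.

(* Euler's Gamma function (meaningful for z > 0). *)
Definition Gamma (R : realType) (z : R) : R :=
  \int[lebesgue_measure]_(x in `]0, +oo[) (x `^ (z - 1) * expR (- x)).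

(* Used only for x > 0, where the absolute value is harmless. *)
Definition nceil (R : realType) (x : R) : nat := `|Num.ceil x|%N.

Definition diff_quotient (R : realType) (g : R -> R) (t : R) : R -> R :=
  fun s => (g s - g t) / (s - t).

(* Derivative at t of a function that matters only on A: the two-sided
   derivative when t is interior to A, and the left derivative at the right
   end point h when A is `]0, h]. *)
Definition derivable_in (R : realType) (A : set R) (g : R -> R) (t : R) : Prop :=
  cvg (diff_quotient g t @ within A t^').

Definition derive_in (R : realType) (A : set R) (g : R -> R) (t : R) : R :=
  lim (diff_quotient g t @ within A t^').

(* One application of (t^(1-rho) / rho) d/dt + sigma. *)
Definition sD1 (R : realType) (sigma rho : R) (A : set R) (g : R -> R) : R -> R :=
  fun t => t `^ (1 - rho) / rho * derive_in A g t + sigma * g t.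

Definition sD (R : realType) (sigma rho : R) (A : set R) (n : nat)
    (g : R -> R) : R -> R :=
  iter n (sD1 sigma rho A) g.

(* [sD] is total, so this records that all the derivatives used in
   [sD sigma rho A n g t] exist. *)
Fixpoint sD_exists (R : realType) (sigma rho : R) (A : set R) (n : nat)
    (g : R -> R) (t : R) : Prop :=
  if n is k.+1 then
    (\forall s \near within A (nbhs t), sD_exists sigma rho A k g s) /\
    derivable_in A (sD sigma rho A k g) t
  else True.

(* The value at 0, i.e. the limit as t -> 0+. *)
Definition sD_at0 (R : realType) (sigma rho : R) (A : set R) (k : nat)
    (psi : R -> R) : R :=
  lim (sD sigma rho A k psi t @[t --> 0^'+]).

Definition sD_at0_exists (R : realType) (sigma rho : R) (A : set R) (k : nat)
    (psi : R -> R) : Prop :=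
  (\forall t \near 0^'+, sD_exists sigma rho A k psi t) /\
  cvg (sD sigma rho A k psi t @[t --> 0^'+]).

Definition sI_integrand (R : realType) (sigma rho gamma : R) (psi : R -> R)
    (t s : R) : R :=
  (t `^ rho - s `^ rho) `^ (gamma - 1) *
  expR (- sigma * (t `^ rho - s `^ rho)) * s `^ (rho - 1) * psi s.

Definition sI (R : realType) (sigma rho gamma : R) (psi : R -> R) (t : R) : R :=
  if gamma == 0 then psi t
  else rho / Gamma gamma *
    \int[lebesgue_measure]_(s in `[0, t]) sI_integrand sigma rho gamma psi t s.

Definition sI_exists (R : realType) (sigma rho gamma : R) (psi : R -> R)
    (t : R) : Prop :=
  gamma != 0 ->
  (@lebesgue_measure R).-integrable `[0, t]
    (fun s => (sI_integrand sigma rho gamma psi t s)%:E).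

Definition sRL (R : realType) (sigma rho : R) (A : set R) (gamma : R)
    (psi : R -> R) : R -> R :=
  sD sigma rho A (nceil gamma) (sI sigma rho ((nceil gamma)%:R - gamma) psi).

Definition sTaylor (R : realType) (sigma rho : R) (A : set R) (n : nat)
    (psi : R -> R) (t : R) : R :=
  \sum_(k < n) sD_at0 sigma rho A k psi / (k`!)%:R *
    t `^ (rho * k%:R) * expR (- sigma * t `^ rho).

Definition sCaputo (R : realType) (sigma rho : R) (A : set R) (gamma : R)
    (psi : R -> R) : R -> R :=
  sRL sigma rho A gamma
    (fun s => psi s - sTaylor sigma rho A (nceil gamma) psi s).

(* The operators are total; [sCaputo_exists] records that the initial values,
   the (absolutely convergent) integrals and the outer derivatives entering
   [sCaputo] exist at every point of A. *)
Definition sCaputo_exists (R : realType) (sigma rho : R) (A : set R)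
    (gamma : R) (psi : R -> R) : Prop :=
  let n := nceil gamma in
  let chi := fun s => psi s - sTaylor sigma rho A n psi s in
  [/\ forall k, (k < n)%N -> sD_at0_exists sigma rho A k psi,
      forall t, A t -> sI_exists sigma rho (n%:R - gamma) chi t &
      forall t, A t ->
        sD_exists sigma rho A n (sI sigma rho (n%:R - gamma) chi) t].

Definition domH (R : realType) (sigma rho : R) (m : nat) (b : nat -> R)
    (K hstar : R) : set (R * R) :=
  [set p | 0 <= p.1 <= hstar /\
     `|p.2 - expR (- sigma * p.1 `^ rho) *
         \sum_(k < m) b k / Gamma (k%:R + 1) * p.1 `^ (rho * k%:R)| <= K].

(* Functions on [0, h] are represented by functions on R of which only the
   restriction to [0, h] matters. *)
Definition is_solution (R : realType) (sigma rho gamma : R) (b : nat -> R)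
    (H : set (R * R)) (f : R * R -> R) (h : R) (psi : R -> R) : Prop :=
  let A := `]0, h]%classic in
  [/\ {within `[0, h], continuous psi},
      forall t : R, 0 <= t <= h -> H (t, psi t),
      sCaputo_exists sigma rho A gamma psi,
      forall t : R, 0 < t <= h -> sCaputo sigma rho A gamma psi t = f (t, psi t) &
      forall k, (k < nceil gamma)%N ->
        sD_at0_exists sigma rho A k psi /\ sD_at0 sigma rho A k psi = b k].

Definition solution_defined (R : realType) (sigma rho gamma : R) (b : nat -> R)
    (H : set (R * R)) (f : R * R -> R) (h : R) : Prop :=
  exists2 psi, is_solution sigma rho gamma b H f h psi &
    forall psi', is_solution sigma rho gamma b H f h psi' ->
      forall t : R, 0 <= t <= h -> psi' t = psi t.

(* All terms are nonnegative, so the base value 0 only matters for the empty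
   range m' <= m, where the result is 0. *)
Definition max_abs_coef (R : realType) (b : nat -> R) (m m' : nat) : R :=
  \big[Num.max/0]_(m <= k < m') `|b k|.

(* Main.v *)
Require Import Defs.
From HB Require Import structures.
From mathcomp Require Import all_boot all_order all_algebra.
From mathcomp Require Import all_classical all_reals all_analysis measurable_realfun.
From mathcomp Require Import ring lra.
Import Order.TTheory GRing.Theory Num.Theory.
Import numFieldNormedType.Exports.

(** The problem becomes classical in the variable [x = t `^ rho] after the solution
    is multiplied by [expR (sigma * x)]: the substantial derivative turns into
    ordinary differentiation and the substantial integral into the
    Riemann-Liouville integral [RL].  The map [twist] undoes this normalization
    ([sD_twist], [untwist_chain], [sI_RL]).

    For the normalized function [G] the Caputo problem of order [gamma] is
    equivalent to the Volterra equation [G = taylor b n + RL gamma Phi], where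
    [n] is the ceiling of [gamma] and [Phi] the normalized right-hand side along
    the solution.  Both directions rest on the semigroup law of [RL], which
    comes from the Beta integral [kern_conv].  From the integral equation to the
    differential one, one differentiates ([volterra_is_solution]).  Conversely,
    the differential equation determines [RL (n - gamma) (G - taylor b n)] up to
    a polynomial of degree below [n]; the initial conditions make this
    polynomial negligible before [x ^+ n.-1], hence zero ([chain_zero]), and
    [RL] is injective ([solution_is_volterra]).

    The right-hand side is extended to the plane by projection onto its domain
    ([clipped_rhs]).  On an interval [0, X] with [L * kern (gamma + 1) X] at most
    1/2 the Volterra operator halves distances.  This gives existence by Picard
    iteration ([volterra_exists]), and it shows that two functions differ by at
    most twice the difference of their residuals ([volterra_stability]), which
    covers uniqueness and the final estimate at once.  If moreover [X] is small
    compared with [K], the solution never leaves the domain and the projection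
    is harmless.

    For the estimate, the solution of order [alpha'] is inserted into the
    equation of order [alpha].  Its residual consists of the difference of the
    Taylor parts, at most [eps'] since only one coefficient is added and
    [X <= 1], and of the change of the integral with its order.  The latter is
    bounded by a multiple of [eps], since the kernel
    [x `^ (a - 1) / Gamma a] is Lipschitz in [a] from the right with an
    integrable constant ([kern_order_diff], [RL_order_diff]).  The same bound
    keeps the contraction condition valid for all orders close to [alpha], so
    that a single [X], hence a single [h = X `^ rho^-1], serves all of them. *)

Set Implicit Arguments.
Unset Strict Implicit.
Unset Printing Implicit Defensive.
Local Open Scope classical_set_scope.
Local Open Scope ring_scope.


(** * Change of variables *)

Section substitution.
Context {R : realType}.
Notation mu := (@lebesgue_measure R).

(** The derivative of [F] may blow up at the end points, as it does for powers
    below 1, so the substitution is made on the closed intervals [S i] and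
    passed to the limit by monotone convergence. *)
Lemma ge0_integral_subst_oo (F dF G : R -> R) (a b : R) : a < b ->
  {in `[a, b] &, {homo F : s t / s < t}} ->
  (forall s, s \in `]a, b[ -> is_derive s 1 F (dF s)) ->
  {in `]a, b[, continuous dF} -> {in `]a, b[, forall s, 0 <= dF s} ->
  F s @[s --> a^'+] --> F a -> F s @[s --> b^'-] --> F b ->
  {in `]F a, F b[, continuous G} ->
  {in `]F a, F b[, forall y, 0 <= G y} ->
  (\int[mu]_(y in `]F a, F b[) (G y)%:E =
   \int[mu]_(s in `]a, b[) (G (F s) * dF s)%:E)%E.
Proof.
move=> ab Finc Fder dFc dF0 Fa Fb Gc G0.
pose e i : R := (b - a) / i.+2%:R.
have e_gt0 i : 0 < e i by rewrite divr_gt0 ?subr_gt0.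
have e_le i : a + e i <= b - e i.
  rewrite -subr_ge0 (_ : _ - _ = (b - a) - 2 * e i); last by ring.
  rewrite subr_ge0 /e mulrA ler_pdivrMr// mulrC ler_pM2l ?subr_gt0//.
  by rewrite ler_nat.
have e_cvg : e i @[i --> \oo] --> 0.
  rewrite -[X in _ --> X](mulr0 (b - a)); apply: cvgM; first exact: cvg_cst.
  by have := @cvg_harmonic R; rewrite -cvg_shiftS.
have e_dec i j : (i <= j)%N -> e j <= e i.
  by move=> ij; rewrite ler_pM2l ?subr_gt0// lef_pV2 ?posrE// ler_nat !ltnS.
have ina i : a + e i \in `]a, b[.
  by rewrite in_itv/= ltrDl e_gt0/= (le_lt_trans (e_le i))// ltrBlDr ltrDl.
have inb i : b - e i \in `]a, b[.
  by rewrite in_itv/= [b - _ < b]ltrBlDr ltrDl e_gt0 andbT (lt_le_trans _ (e_le i))// ltrDl.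
have sub s : s \in `]a, b[ -> s \in `[a, b] by apply: subset_itv_oo_cc.
have Fle s t : s \in `[a, b] -> t \in `[a, b] -> s <= t -> F s <= F t.
  move=> sab tab; rewrite le_eqVlt => /predU1P[->//|st].
  by apply/ltW/Finc.
have ain : a \in `[a, b] by rewrite in_itv/= lexx ltW.
have bin : b \in `[a, b] by rewrite in_itv/= lexx ltW.
pose S i : set R := `[a + e i, b - e i]%classic.
pose T i : set R := `[F (a + e i), F (b - e i)]%classic.
have SU : `]a, b[%classic = \bigcup_i S i.
  apply/seteqP; split=> [s|s [i _]]; rewrite /S /= !in_itv/=; last first.
    move=> /andP[ls sl]; have := ina i; have := inb i; rewrite !in_itv/=.
    move=> /andP[_ ?] /andP[? _]; apply/andP; split; first exact: lt_le_trans ls.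
    exact: le_lt_trans sl _.
  move=> /andP[sa sb].
  have d_gt0 : 0 < Num.min (s - a) (b - s) by rewrite lt_min !subr_gt0 sa.
  have /cvgr0Pnorm_le /(_ _ d_gt0) [N _ HN] := e_cvg.
  have /= := HN N (leqnn N); rewrite gtr0_norm// le_min => /andP[? ?].
  by exists N => //=; rewrite in_itv/=; apply/andP; split; lra.
have Sin i s : s \in `[a + e i, b - e i] -> s \in `]a, b[.
  move=> /= sS; suff : `]a, b[%classic s by [].
  by rewrite SU; exists i.
have TU : `]F a, F b[%classic = \bigcup_i T i.
  apply/seteqP; split=> [y|y [i _]]; rewrite /T /= !in_itv/=; last first.
    move=> /andP[ly yl]; apply/andP; split.
      apply: lt_le_trans ly; apply: Finc => //; first exact/sub.
      by rewrite ltrDl.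
    apply: le_lt_trans yl _; apply: Finc => //; first exact/sub.
    by rewrite ltrBlDr ltrDl.
  move=> /andP[ya yb].
  have [d1 /= d10 H1] : \forall s \near a^'+, F s < y.
    by move: Fa => /cvgr_lt; apply.
  have [d2 /= d20 H2] : \forall s \near b^'-, y < F s.
    by move: Fb => /cvgr_gt; apply.
  have d_gt0 : 0 < Num.min d1 d2 by rewrite lt_min d10.
  have /cvgr0Pnorm_lt /(_ _ d_gt0) [N _ HN] := e_cvg.
  have /= := HN N (leqnn N); rewrite gtr0_norm// lt_min => /andP[e1 e2].
  exists N => //=; rewrite in_itv/=; apply/andP; split.
    apply/ltW/H1; last by rewrite ltrDl.
    by rewrite /ball_/= opprD addrA subrr add0r normrN gtr0_norm.
  apply/ltW/H2; last by rewrite ltrBlDr ltrDl.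
  by rewrite /ball_/= opprB addrC subrK gtr0_norm.
have F1 s : s \in `]a, b[ -> (derive1 F) s = dF s.
  by move=> sab; rewrite derive1E; apply: derive_val; exact: Fder.
have near_oo s : s \in `]a, b[ -> \forall t \near s, t \in `]a, b[.
  by move=> sab; apply: near_in_itvoo.
have F1c s : s \in `]a, b[ -> {for s, continuous (derive1 F)}.
  move=> sab; rewrite /prop_for /continuous_at F1//.
  apply: cvg_trans (dFc _ sab); apply: near_eq_cvg.
  by near=> t; rewrite F1//; near: t; exact: near_oo.
have Fc s : s \in `]a, b[ -> {for s, continuous F}.
  move=> sab; apply/differentiable_continuous/derivable1_diffP.
  by have [] := Fder s sab.
have Tin i y : y \in `[F (a + e i), F (b - e i)] -> y \in `]F a, F b[.
  move=> yT; suff : `]F a, F b[%classic y by [].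
  by rewrite TU; exists i.
rewrite SU TU.
(* On [S i] the function [F] is continuously differentiable up to the ends. *)
have SI i : (\int[mu]_(y in T i) (G y)%:E =
             \int[mu]_(s in S i) (G (F s) * dF s)%:E)%E.
  rewrite integration_by_substitution_increasing//.
  - by apply: eq_integral => s; rewrite inE/= => /Sin sab; rewrite /GRing.mul/= F1.
  - move=> s t sS tS; apply: Finc; apply/sub; [exact: Sin sS|exact: Sin tS].
  - move=> s sS; apply: F1c; apply: (@Sin i); exact: subset_itv_oo_cc sS.
  - apply/cvg_ex; exists ((derive1 F) (a + e i)); apply: cvg_at_right_filter; exact: F1c.
  - apply/cvg_ex; exists ((derive1 F) (b - e i)); apply: cvg_at_left_filter; exact: F1c.
  - split.
    + move=> s sS; have /Fder[]// : s \in `]a, b[.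
      by apply: (@Sin i); exact: subset_itv_oo_cc sS.
    + by apply: cvg_at_right_filter; exact: Fc.
    + by apply: cvg_at_left_filter; exact: Fc.
  - by apply: continuous_in_subspaceT => y /set_mem /= yT; apply: Gc; exact: Tin yT.
have Snd : nondecreasing_seq S.
  move=> i j ij; rewrite subsetEset => s; rewrite /S/= !in_itv/= => /andP[ls sl].
  by have := e_dec _ _ ij => ?; apply/andP; split; lra.
have Tnd : nondecreasing_seq T.
  move=> i j ij; rewrite subsetEset => s; rewrite /T/= !in_itv/= => /andP[ls sl].
  have := e_dec _ _ ij => ?; apply/andP; split.
    by apply: le_trans ls; apply: Fle; [exact/sub|exact/sub|rewrite lerD2l].
  by apply: le_trans sl _; apply: Fle; [exact/sub|exact/sub|rewrite lerD2l lerN2].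
have mT i : measurable_fun (T i) (EFin \o G).
  have Gw : {within T i, continuous G}.
    apply: continuous_in_subspaceT => y /set_mem yT.
    apply: Gc.
    by apply: (@Tin i); exact: yT.
  apply/measurable_EFinP; apply: subspace_continuous_measurable_fun Gw.
  exact: measurable_itv.
have mS i : measurable_fun (S i) (EFin \o (fun s => G (F s) * dF s)).
  have Gw : {within S i, continuous (fun s => G (F s) * dF s)}.
    apply: continuous_in_subspaceT => s /set_mem sS.
    have sab : s \in `]a, b[ by apply: (@Sin i); exact: sS.
    apply: cvgM; last exact: dFc.
    apply: (@continuous_comp _ _ _ F G); first exact: Fc.
    apply: Gc; move: (sab); rewrite !in_itv/= => /andP[? ?].
    by apply/andP; split; apply: Finc => //; exact/sub.
  apply/measurable_EFinP; apply: subspace_continuous_measurable_fun Gw.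
  exact: measurable_itv.
have cT : (\int[mu]_(y in T i) (G y)%:E @[i --> \oo] -->
           \int[mu]_(y in \bigcup_i T i) (G y)%:E)%E.
  apply: ge0_nondecreasing_set_cvg_integral => //.
    by move=> i; exact: measurable_itv.
  by move=> i y yT; rewrite lee_fin G0//; apply: (@Tin i); exact: yT.
move: cT; rewrite (funext SI) => cT; apply: (cvg_unique _ cT) => //.
apply: ge0_nondecreasing_set_cvg_integral => //.
  by move=> i; exact: measurable_itv.
move=> i s sS; have sab : s \in `]a, b[ by apply: (@Sin i); exact: sS.
rewrite lee_fin mulr_ge0 ?dF0// G0//.
move: (sab); rewrite !in_itv/= => /andP[? ?].
by apply/andP; split; apply: Finc => //; exact/sub.
Unshelve. all: by end_near. Qed.

End substitution.

Section affine.
Context {R : realType}.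
Notation mu := (@lebesgue_measure R).

Let aff (c d : R) : measurableTypeR R -> measurableTypeR R := fun x => c * x + d.

Let measurable_aff c d : measurable_fun setT (aff c d).
Proof. by apply: measurable_funD => //; apply: measurable_funM. Qed.

Let aff_image c d : {measure set (measurableTypeR R) -> \bar R} :=
  mscale (NngNum (normr_ge0 c))
    (measure_function_pushforward__canonical__measure_function_Measure mu
       (measurable_aff c d)).

(** As a function of [A] the left-hand side is a measure that gives half-open
    intervals their length, which characterizes Lebesgue measure. *)
Lemma lebesgue_measure_affine (c d : R) (A : set (measurableTypeR R)) : c != 0 ->
  measurable A ->
  (`|c|%:E * pushforward mu (aff c d) A = mu A)%E.
Proof.
move=> c0 mA.
suff -> : mu A = aff_image c d A by [].
apply: lebesgue_measure_unique => //= _ [[p q]] _ <-.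
rewrite /aff_image /mscale /= /pushforward/=.
have [cn|cp|/eqP] := ltgtP c 0; last by rewrite (negPf c0).
- have -> : aff c d @^-1` `]p, q] = `[(q - d) / c, (p - d) / c[%classic.
    apply/seteqP; split=> x /=; rewrite /aff !in_itv/= ler_ndivrMr// ltr_ndivlMr//;
     rewrite lerBrDr ltrBlDr mulrC => /andP[? ?]; exact/andP.
  rewrite !lebesgue_measure_itv/= !lte_fin ltr_ndivrMr// mulfVK// ltrD2r.
  case: ifP => _; last by rewrite mule0.
  by rewrite -!EFinD -EFinM ltr0_norm//; congr EFin; field.
- have -> : aff c d @^-1` `]p, q] = `](p - d) / c, (q - d) / c]%classic.
    apply/seteqP; split=> x /=; rewrite /aff !in_itv/= ler_pdivlMr// ltr_pdivrMr//;
     rewrite lerBrDr ltrBlDr mulrC => /andP[? ?]; exact/andP.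
  rewrite !lebesgue_measure_itv/= !lte_fin ltr_pdivrMr// mulfVK ?gt_eqF// ltrD2r.
  case: ifP => _; last by rewrite mule0.
  by rewrite -!EFinD -EFinM gtr0_norm//; congr EFin; field; rewrite gt_eqF.
Qed.

Lemma ge0_integral_affine (c d : R) (f : R -> R) : c != 0 ->
  measurable_fun setT f -> (forall x, 0 <= f x) ->
  (\int[mu]_x (f x)%:E = `|c|%:E * \int[mu]_x (f (c * x + d)%R)%:E)%E.
Proof.
move=> c0 mf f0.
transitivity (\int[aff_image c d]_x (f x)%:E)%E.
  apply: eq_measure_integral => //= A mA _.
  by rewrite -(lebesgue_measure_affine d c0).
rewrite ge0_integral_mscale//; last 2 first.
- exact/measurable_EFinP.
- by move=> x _; rewrite lee_fin.
congr (_ * _)%E; rewrite ge0_integral_pushforward//; first exact/measurable_EFinP.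
by move=> x _; rewrite lee_fin.
Qed.

Lemma ge0_integral_mull (c : R) (f : R -> R) : 0 <= c ->
  measurable_fun setT f -> (forall x, 0 <= f x) ->
  (\int[mu]_x (c * f x)%:E = c%:E * \int[mu]_x (f x)%:E)%E.
Proof.
move=> c0 mf f0; under eq_integral do rewrite EFinM.
by rewrite ge0_integralZl_EFin//; [move=> x _; rewrite lee_fin|exact/measurable_EFinP].
Qed.

End affine.

(** * Linearity and monotonicity of real-valued integrals *)

Section integrable_real.
Context {R : realType}.
Notation mu := (@lebesgue_measure R).
Implicit Types (D : set (measurableTypeR R)) (f g : R -> R).

Lemma integrable_add D f g : measurable D -> mu.-integrable D (EFin \o f) ->
  mu.-integrable D (EFin \o g) -> mu.-integrable D (EFin \o (fun x => f x + g x)).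
Proof. by move=> mD fi gi; apply: eq_integrable (integrableD mD fi gi). Qed.

Lemma integrable_sub D f g : measurable D -> mu.-integrable D (EFin \o f) ->
  mu.-integrable D (EFin \o g) -> mu.-integrable D (EFin \o (fun x => f x - g x)).
Proof. by move=> mD fi gi; apply: eq_integrable (integrableB mD fi gi). Qed.

Lemma integrable_scale D (c : R) f : measurable D -> mu.-integrable D (EFin \o f) ->
  mu.-integrable D (EFin \o (fun x => c * f x)).
Proof. by move=> mD fi; apply: eq_integrable (integrableZl mD c fi). Qed.

Lemma integrable_le D f g : measurable D -> measurable_fun D f ->
  (forall x, D x -> `|f x| <= g x) ->
  mu.-integrable D (EFin \o g) -> mu.-integrable D (EFin \o f).
Proof.
move=> mD mf fg ig; apply: (le_integrable mD _ _ ig); first exact/measurable_EFinP.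
by move=> x Dx /=; rewrite lee_fin; apply: le_trans (fg x Dx) (ler_norm _).
Qed.

Lemma Rintegral_add D f g : measurable D -> mu.-integrable D (EFin \o f) ->
  mu.-integrable D (EFin \o g) ->
  \int[mu]_(x in D) (f x + g x) = \int[mu]_(x in D) f x + \int[mu]_(x in D) g x.
Proof. by move=> mD fi gi; rewrite RintegralD. Qed.

Lemma Rintegral_sub D f g : measurable D -> mu.-integrable D (EFin \o f) ->
  mu.-integrable D (EFin \o g) ->
  \int[mu]_(x in D) (f x - g x) = \int[mu]_(x in D) f x - \int[mu]_(x in D) g x.
Proof. by move=> mD fi gi; rewrite RintegralB. Qed.

Lemma Rintegral_scale D (c : R) f : measurable D -> mu.-integrable D (EFin \o f) ->
  \int[mu]_(x in D) (c * f x) = c * \int[mu]_(x in D) f x.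
Proof. by move=> mD fi; rewrite RintegralZl. Qed.

Lemma Rintegral_norm_le D f g : measurable D -> mu.-integrable D (EFin \o f) ->
  mu.-integrable D (EFin \o g) -> (forall x, D x -> `|f x| <= g x) ->
  `|\int[mu]_(x in D) f x| <= \int[mu]_(x in D) g x.
Proof.
move=> mD fi gi fg; apply: le_trans (le_normr_Rintegral mD fi) _.
by apply: le_Rintegral mD (integrable_norm fi) gi _.
Qed.

End integrable_real.

(** * The Gamma function *)

Section gamma.
Context {R : realType}.
Notation mu := (@lebesgue_measure R).
Implicit Types a b u x : R.

Lemma continuous_powR (r x : R) : 0 < x -> {for x, continuous (@powR R ^~ r)}.
Proof.
move=> x0; apply/differentiable_continuous/derivable1_diffP.
by apply: derivable_powR; rewrite in_itv/= x0.
Qed.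

(** For [r < 1] the weight [s `^ (r - 1)] is unbounded at [0]. *)
Lemma ge0_integral_subst_powR (r x : R) (G : R -> R) : 0 < r -> 0 < x ->
  {in `]0, x `^ r[, continuous G} -> {in `]0, x `^ r[, forall y, 0 <= G y} ->
  (\int[mu]_(y in `]0%R, (x `^ r)%R[) (G y)%:E =
   \int[mu]_(s in `]0%R, x[) (G (s `^ r) * (r * s `^ (r - 1)))%:E)%E.
Proof.
move=> r0 x0 cG G0.
have Finc : {in `[0, x] &, {homo @powR R ^~ r : s t / s < t}}.
  move=> s t; rewrite !in_itv/= => /andP[s0 _] /andP[t0 _] st.
  by apply: gt0_ltr_powR => //; rewrite nnegrE.
have Fder s : s \in `]0, x[ -> is_derive s 1 (@powR R ^~ r) (r * s `^ (r - 1)).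
  by rewrite in_itv/= => /andP[s0 _]; exact: is_derive1_powR.
have F0 : (0 : R) `^ r = 0 by rewrite powR0 ?gt_eqF.
have := ge0_integral_subst_oo x0 Finc Fder; rewrite F0; apply=> //.
- move=> s; rewrite in_itv/= => /andP[s0 _].
  by apply: cvgM; [exact: cvg_cst|exact: continuous_powR].
- by move=> s _; rewrite mulr_ge0 ?powR_ge0// ltW.
- exact: powR_cvg0.
- by apply: cvg_at_left_filter; exact: continuous_powR.
Qed.

Lemma integral_powR01 a : 0 < a ->
  (\int[mu]_(s in `]0%R, 1%R[) (s `^ (a - 1))%:E = (a^-1)%:E)%E.
Proof.
move=> a0.
have : (\int[mu]_(s in `]0%R, 1%R[) (1 * (a * s `^ (a - 1)))%:E = 1%:E)%E.
  rewrite -(@ge0_integral_subst_powR a 1 (fun=> 1))//; last first.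
    by move=> y _; exact: cvg_cst.
  by rewrite powR1 integral_cst//= mul1e lebesgue_measure_itv/= lte_fin ltr01 sube0.
under eq_integral do rewrite mul1r EFinM.
rewrite ge0_integralZl_EFin//=; last 3 first.
- by move=> x _; rewrite lee_fin powR_ge0.
- by apply/measurable_EFinP; apply: measurable_funTS; exact: measurable_powR.
- exact: ltW.
move=> /(congr1 (fun z => (a^-1)%:E * z)%E).
by rewrite muleA -EFinM mulVf ?gt_eqF// mul1e mule1.
Qed.

Lemma ln_le_subr1 x : 0 < x -> ln x <= x - 1.
Proof. by move=> x0; rewrite -{1}(subrKC 1 x) le_ln1Dx//; lra. Qed.

Definition gamma_integrand a x : R := x `^ (a - 1) * expR (- x).

Lemma gamma_integrand_ge0 a x : 0 <= gamma_integrand a x.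
Proof. by rewrite mulr_ge0 ?powR_ge0 ?expR_ge0. Qed.

Lemma measurable_gamma_integrand a : measurable_fun setT (gamma_integrand a).
Proof.
apply: measurable_funM; first exact: measurable_powR.
by apply: measurableT_comp.
Qed.

(** Below 1 the integrand is dominated by its power, above 1 by a multiple of
    the exponential density of rate 1/2: the inequality [ln u <= u - 1] at
    [u = x / (2 * a)] shows that the power costs at most half of the decay. *)
Lemma integrable_gamma a : 0 < a ->
  mu.-integrable `]0, +oo[ (EFin \o gamma_integrand a).
Proof.
move=> a0; pose c := a * ln (2 * a).
pose g1 : R -> R := (fun s => s `^ (a - 1)) \_ `]0, 1[.
pose g2 : R -> R := exponential_pdf 2^-1.
have ig1 : mu.-integrable setT (EFin \o g1).
  rewrite /g1 -restrict_EFin; apply/integrable_restrict => //; rewrite setTI.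
  apply/integrableP; split.
    by apply/measurable_EFinP; apply: measurable_funTS; exact: measurable_powR.
  under eq_integral do rewrite gee0_abs ?lee_fin ?powR_ge0//.
  by rewrite integral_powR01// ltry.
have ig2 : mu.-integrable setT (EFin \o g2) by exact: integrable_exponential_pdf.
have ig : mu.-integrable setT (fun x => (g1 x)%:E + (2 * expR c)%:E * (g2 x)%:E)%E.
  by apply: integrableD => //; apply: integrableZl.
apply: le_integrable (integrableS _ _ _ ig) => //.
  by apply/measurable_EFinP; apply: measurable_funTS; exact: measurable_gamma_integrand.
move=> x /=; rewrite in_itv/= andbT => x0.
rewrite lee_fin ger0_norm ?gamma_integrand_ge0//.
have g10 : 0 <= g1 x by apply: restrict_ge0 => s _; exact: powR_ge0.
have g20 : 0 <= g2 x by exact: exponential_pdf_ge0.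
have c0 : 0 <= 2 * expR c by rewrite mulr_ge0 ?expR_ge0.
rewrite ger0_norm ?addr_ge0 ?mulr_ge0//.
have [x1|x1] := ltP x 1.
  apply: (@le_trans _ _ (g1 x)); last by rewrite lerDl mulr_ge0.
  rewrite /g1 patchE ifT ?inE/= ?in_itv/= ?x0//.
  rewrite /gamma_integrand ler_piMr ?powR_ge0//.
  by rewrite -expR0 ler_expR oppr_le0 ltW.
apply: (@le_trans _ _ (2 * expR c * g2 x)); last by rewrite lerDr.
rewrite /g2 exponential_pdfE ?(ltW x0)// /gamma_integrand.
rewrite [leRHS](_ : _ = expR (c - x / 2)); last first.
  by rewrite expRD mulrACA divff// mul1r; congr (expR _ * expR _); lra.
rewrite /powR gt_eqF// -expRD ler_expR /c.
have lx0 : 0 <= ln x by exact: ln_ge0.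
have : ln (x / (2 * a)) <= x / (2 * a) - 1 by apply: ln_le_subr1; rewrite divr_gt0// mulr_gt0.
rewrite ln_div ?posrE ?mulr_gt0// => H.
have : a * (ln x - ln (2 * a)) <= a * (x / (2 * a) - 1) by rewrite ler_pM2l.
have -> : a * (x / (2 * a) - 1) = x / 2 - a by field; rewrite gt_eqF.
nra.
Qed.

Lemma EFin_Gamma a : 0 < a ->
  (\int[mu]_(x in `]0%R, +oo[) (gamma_integrand a x)%:E = (Gamma a)%:E)%E.
Proof.
move=> a0; rewrite /Gamma /Rintegral fineK//.
by apply: integrable_fin_num => //; exact: integrable_gamma.
Qed.

(** On [`[1, 2]] the integrand is at least [expR (- `|a - 1| - 2)]. *)
Lemma Gamma_gt0 a : 0 < a -> 0 < Gamma a.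
Proof.
move=> a0; pose c := expR (- `|a - 1| - 2).
rewrite -lte_fin -EFin_Gamma//.
apply: (@lt_le_trans _ _ (\int[mu]_(x in `[1%R, 2%R]) c%:E)%E).
  rewrite integral_cst//= lebesgue_measure_itv/= lte_fin ltr1n -EFinD -EFinM lte_fin.
  by rewrite mulr_gt0 ?expR_gt0//; lra.
apply: (@le_trans _ _ (\int[mu]_(x in `[1%R, 2%R]) (gamma_integrand a x)%:E)%E).
  apply: ge0_le_integral => //.
  - by move=> x _; rewrite lee_fin expR_ge0.
  - by apply/measurable_EFinP; apply: measurable_funTS; exact: measurable_gamma_integrand.
  - move=> x /=; rewrite in_itv/= => /andP[x1 x2]; rewrite lee_fin.
    have x0 : 0 < x by lra.
    rewrite /gamma_integrand /powR gt_eqF// -expRD ler_expR.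
    have l0 : 0 <= ln x by exact: ln_ge0.
    have l1 : ln x <= 1 by apply: le_trans (ln_le_subr1 x0) _; lra.
    have : - `|a - 1| <= (a - 1) * ln x.
      rewrite lerNl -mulNr; apply: le_trans (ler_norm _) _.
      by rewrite normrM normrN (ger0_norm l0) ler_piMr.
    lra.
apply: ge0_subset_integral => //.
- by apply/measurable_EFinP; apply: measurable_funTS; exact: measurable_gamma_integrand.
- by move=> x _; rewrite lee_fin gamma_integrand_ge0.
- by move=> x /=; rewrite !in_itv/= andbT => /andP[+ _]; apply: lt_le_trans.
Qed.

Lemma Gamma1 : Gamma (1 : R) = 1.
Proof.
apply: EFin_inj; rewrite -EFin_Gamma//.
rewrite -(@integral_exponential_pdf R 1)//.
transitivity (\int[mu]_x ((EFin \o (fun x => expR (- x))) \_ `[0%R, +oo[) x)%E; last first.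
  rewrite restrict_EFin; apply: eq_integral => x _ /=; congr EFin.
  rewrite /exponential_pdf; congr ((_ \_ _) _); apply/funext => y.
  by rewrite mul1r mulN1r.
rewrite -integral_mkcond -integral_itv_obnd_cbnd; last first.
  by apply/measurable_EFinP; apply: measurable_funTS; apply: measurableT_comp.
by apply: eq_integral => x _; rewrite /gamma_integrand subrr powRr0 mul1r.
Qed.

End gamma.

(** * The kernel of fractional integration *)

Section kernel.
Context {R : realType}.
Notation mu := (@lebesgue_measure R).
Implicit Types a b c u x y : R.

(** The kernel of the Riemann-Liouville integral of order [a].  Its vanishing on
    the negative axis turns integrals over [0, x] into convolutions over the
    whole line. *)
Definition kern a u : R := if 0 < u then u `^ (a - 1) / Gamma a else 0.

Lemma kern_gt0E a u : 0 < u -> kern a u = u `^ (a - 1) / Gamma a.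
Proof. by rewrite /kern => ->. Qed.

Lemma kern_le0 a u : u <= 0 -> kern a u = 0.
Proof. by rewrite /kern ltNge => ->. Qed.

Lemma kern_ge0 a u : 0 < a -> 0 <= kern a u.
Proof.
by move=> a0; rewrite /kern; case: ifP => // _; rewrite divr_ge0 ?powR_ge0// ltW// Gamma_gt0.
Qed.

Lemma measurable_kern a : measurable_fun setT (kern a).
Proof.
apply: measurable_fun_ifT => //; first exact: measurable_fun_ltr.
by apply: measurable_funM => //; exact: measurable_powR.
Qed.

Lemma measurable_kernB a x : measurable_fun setT (fun y => kern a (x - y)).
Proof. by apply: measurableT_comp (measurable_kern a) _; exact: measurable_funB. Qed.

Lemma kern1 u : kern 1 u = (0 < u)%R%:R.
Proof. by rewrite /kern subrr powRr0 Gamma1 divr1; case: ifP. Qed.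

Lemma kernM a c u : 0 < c -> kern a (c * u) = c `^ (a - 1) * kern a u.
Proof.
move=> c0; rewrite /kern pmulr_rgt0//; case: ifP => [u0|_]; last by rewrite mulr0.
by rewrite powRM ?ltW// mulrA.
Qed.

Lemma kern_expR a u : kern a u * expR (- u) =
  (Gamma a)^-1 * (gamma_integrand a \_ `]0, +oo[) u.
Proof.
rewrite /kern patchE mem_setE in_itv/= andbT; case: ifP => _; last by rewrite mul0r mulr0.
by rewrite mulrAC mulrC.
Qed.

(** The Laplace transform of the kernel at 1; the factor [Gamma a] in the
    definition of [kern] normalizes it. *)
Lemma integral_kern_expR a : 0 < a ->
  (\int[mu]_u (kern a u * expR (- u))%:E = 1)%E.
Proof.
move=> a0; under eq_integral do rewrite kern_expR.
have G0 := Gamma_gt0 a0.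
rewrite ge0_integral_mull; last 3 first.
- by rewrite invr_ge0 ltW.
- apply/(measurable_restrictT (gamma_integrand a)) => //.
  by apply: measurable_funTS; exact: measurable_gamma_integrand.
- by move=> x; apply: restrict_ge0 => y _; exact: gamma_integrand_ge0.
rewrite [X in (_ * X)%E](_ : _ = (Gamma a)%:E).
  by rewrite -EFinM mulVf ?gt_eqF.
by rewrite -EFin_Gamma// [RHS]integral_mkcond restrict_EFin.
Qed.

Lemma measurable_kern_kern a b x :
  measurable_fun setT (fun y => kern a (x - y) * kern b y).
Proof. by apply: measurable_funM; [exact: measurable_kernB|exact: measurable_kern]. Qed.

Lemma measurable_kern_expR a : measurable_fun setT (fun u => kern a u * expR (- u)).
Proof. by apply: measurable_funM; [exact: measurable_kern|apply: measurableT_comp]. Qed.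

Let integral_kernB_expR a b y : 0 < a -> 0 < b ->
  (\int[mu]_t (kern a (t - y) * kern b y * expR (- t))%:E =
   (kern b y * expR (- y))%:E)%E.
Proof.
move=> a0 b0; have mh : measurable_fun setT
    (fun t : R => kern a (t - y) * kern b y * expR (- t)).
  apply: measurable_funM; last by apply: measurableT_comp.
  apply: measurable_funM; last exact: measurable_cst.
  by apply: measurableT_comp (measurable_kern a) _; exact: measurable_funB.
rewrite (ge0_integral_affine y (oner_neq0 _) mh); last first.
  by move=> t; rewrite !mulr_ge0 ?kern_ge0 ?expR_ge0.
rewrite normr1 mul1e.
have hE (u : R) : kern a (1 * u + y - y) * kern b y * expR (- (1 * u + y)) =
    (kern b y * expR (- y)) * (kern a u * expR (- u)).
  by rewrite mul1r addrK opprD expRD [kern a u * kern b y]mulrC [expR (- u) * _]mulrC mulrACA.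
under eq_integral => u _ do rewrite hE.
rewrite ge0_integral_mull; last 3 first.
- by rewrite mulr_ge0 ?kern_ge0 ?expR_ge0.
- exact: measurable_kern_expR.
- by move=> t; rewrite mulr_ge0 ?kern_ge0 ?expR_ge0.
by rewrite integral_kern_expR// mule1.
Qed.

(** This is Euler's Beta integral.  The convolution scales like
    [x `^ (a + b - 1)], which determines it up to its value at 1; comparing
    Laplace transforms at 1 gives that value. *)
Lemma kern_conv a b x : 0 < a -> 0 < b ->
  (\int[mu]_y (kern a (x - y) * kern b y)%:E = (kern (a + b) x)%:E)%E.
Proof.
move=> a0 b0; have ab0 : 0 < a + b by rewrite addr_gt0.
have kk0 (t y : R) : 0 <= kern a (t - y) * kern b y by rewrite mulr_ge0 ?kern_ge0.
have ke0 (c y : R) : 0 < c -> 0 <= kern c y * expR (- y).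
  by move=> c0; rewrite mulr_ge0 ?expR_ge0 ?kern_ge0.
pose N t := (\int[mu]_y (kern a (t - y) * kern b y)%:E)%E.
have NE t : N t = ((t `^ (a + b - 1) * (0 < t)%R%:R)%R%:E * N 1%R)%E.
  have [t0|t0] := ltP 0 t; last first.
    rewrite mulr0 mul0e /N integral0_eq// => y _.
    have [y0|y0] := leP y 0; first by rewrite [kern b y]kern_le0// mulr0.
    by rewrite kern_le0 ?mul0r//; lra.
  rewrite mulr1 {1}/N.
  rewrite (ge0_integral_affine 0 (lt0r_neq0 t0) (measurable_kern_kern a b t) (kk0 t)).
  have kE (y : R) : kern a (t - (t * y + 0)) * kern b (t * y + 0) =
      (t `^ (a - 1) * t `^ (b - 1)) * (kern a (1 - y) * kern b y).
    by rewrite addr0 -{1}[t]mulr1 -mulrBr !kernM// mulrACA.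
  under eq_integral => y _ do rewrite kE.
  rewrite ge0_integral_mull ?mulr_ge0 ?powR_ge0//; last exact: measurable_kern_kern.
  rewrite muleA -EFinM gtr0_norm//; congr (_%:E * _)%E.
  have tD p q : t `^ p * t `^ q = t `^ (p + q) by rewrite powRD ?(gt_eqF t0)?implybT.
  rewrite -{1}(powRr1 (ltW t0)) !tD.
  by congr (_ `^ _); ring.
suff N1 : (N 1%R * (Gamma (a + b)%R)%:E = 1%:E)%E.
  change (N x = (kern (a + b) x)%:E); rewrite NE /kern.
  have G0 := Gamma_gt0 ab0.
  have -> : N 1 = ((Gamma (a + b))^-1)%:E.
    move/(congr1 (fun z => z * ((Gamma (a + b))^-1)%:E)%E): N1.
    by rewrite -muleA -EFinM divff ?gt_eqF// mule1 mul1e.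
  by rewrite -EFinM; case: ltP => _; rewrite ?mulr1 ?mulr0 ?mul0r.
have N10 : (0 <= N 1%R)%E by apply: integral_ge0 => y _; rewrite lee_fin.
(* Both sides are the integral of [N t * expR (- t)]: once by homogeneity of
   [N], once by integrating in [t] first. *)
transitivity (\int[mu]_t (N t * (expR (- t))%:E))%E.
  have NeE t : (N t * (expR (- t))%:E =
      N 1%R * (Gamma (a + b)%R * (kern (a + b) t * expR (- t)))%R%:E)%E.
    rewrite NE muleAC -EFinM muleC; congr (_ * _%:E)%E.
    rewrite /kern; case: ifP => _; last by rewrite mulr0 !mul0r mulr0.
    have := Gamma_gt0 ab0; move: (Gamma _) => G G0.
    by rewrite mulr1 [RHS]mulrA [G * _]mulrCA divff ?mulr1// gt_eqF.
  under eq_integral => t _ do rewrite NeE.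
  rewrite ge0_integralZl//; last 2 first.
  - apply/measurable_EFinP; apply: measurable_funM => //.
    exact: measurable_kern_expR.
  - by move=> t _; rewrite lee_fin mulr_ge0 ?ke0// ltW// Gamma_gt0.
  congr (_ * _)%E; rewrite ge0_integral_mull; last 3 first.
  - by rewrite ltW// Gamma_gt0.
  - exact: measurable_kern_expR.
  - by move=> t; exact: ke0.
  by rewrite integral_kern_expR// mule1.
pose h (p : measurableTypeR R * measurableTypeR R) : R :=
  kern a (p.1 - p.2) * kern b p.2 * expR (- p.1).
have mk2 : measurable_fun setT h.
  apply: measurable_funM; last first.
    by do 2 apply: measurableT_comp => //.
  apply: measurable_funM.
    by apply: measurableT_comp (measurable_kern a) _; exact: measurable_funB.
  by apply: measurableT_comp (measurable_kern b) _.
have h0 p : (0 <= (EFin \o h) p)%E.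
  by rewrite lee_fin !mulr_ge0 ?kern_ge0 ?expR_ge0.
have FT := fubini_tonelli (m1 := mu) (m2 := mu) (EFin \o h)
  ((measurable_EFinP _ _).2 mk2) h0.
transitivity (\int[mu]_t \int[mu]_y (h (t, y))%:E)%E.
  apply: eq_integral => t _; rewrite /N muleC.
  rewrite -(ge0_integral_mull (expR_ge0 _) (measurable_kern_kern a b t) (kk0 t)).
  by apply: eq_integral => y _; rewrite /h/= mulrC.
etransitivity; first exact: FT.
transitivity (\int[mu]_y ((kern b y * expR (- y))%:E))%E; last first.
  by rewrite integral_kern_expR.
by apply: eq_integral => y _ /=; exact: integral_kernB_expR.
Qed.

Lemma kern_conv_shift a b x z : 0 < a -> 0 < b ->
  (\int[mu]_y (kern a (x - y) * kern b (y - z))%:E = (kern (a + b) (x - z))%:E)%E.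
Proof.
move=> a0 b0; rewrite (ge0_integral_affine z (oner_neq0 _)); last 2 first.
- apply: measurable_funM; first exact: measurable_kernB.
  by apply: measurableT_comp (measurable_kern b) _; exact: measurable_funB.
- by move=> y; rewrite mulr_ge0 ?kern_ge0.
rewrite normr1 mul1e -(kern_conv (x - z) a0 b0); apply: eq_integral => y _.
by rewrite mul1r addrK opprD addrA addrAC.
Qed.

(** The functional equation is the convolution law for the orders 1 and [a],
    read at the point 1. *)
Lemma GammaS a : 0 < a -> Gamma (a + 1) = a * Gamma a.
Proof.
move=> a0; have G0 := Gamma_gt0 a0.
have : (\int[mu]_y (kern 1 (1 - y) * kern a y)%:E =
        (Gamma a)^-1%:E * \int[mu]_(y in `]0%R, 1%R[) (y `^ (a - 1))%:E)%E.
  rewrite -ge0_integralZl_EFin//; last 3 first.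
  - by move=> y _; rewrite lee_fin powR_ge0.
  - by apply/measurable_EFinP; apply: measurable_funTS; exact: measurable_powR.
  - by rewrite invr_ge0 ltW.
  rewrite [RHS]integral_mkcond; apply: eq_integral => y _.
  rewrite patchE mem_setE in_itv/= kern1 subr_gt0 /kern.
  case: (0 < y) => /=; last by rewrite mulr0.
  by case: ifP => _; rewrite ?mul0r// mul1r -EFinM mulrC.
rewrite kern_conv// integral_powR01// -EFinM => -[].
rewrite kern_gt0E// powR1 mul1r -invfM => /invr_inj.
by rewrite addrC mulrC.
Qed.

Lemma Gamma_fact (n : nat) : Gamma (n%:R + 1 : R) = n`!%:R.
Proof.
elim: n => [|n IH]; first by rewrite add0r Gamma1.
by rewrite -natr1 GammaS ?ltr_wpDl// IH factS natrM natr1.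
Qed.

Lemma kern_homo c : 1 <= c -> {homo kern c : x y / x <= y}.
Proof.
move=> c1 x y xy; have c0 : 0 < c by lra.
have [x0|x0] := leP x 0; first by rewrite kern_le0 ?kern_ge0.
have y0 : 0 < y by apply: lt_le_trans xy.
rewrite !kern_gt0E// ler_pM2r ?invr_gt0 ?Gamma_gt0//.
by apply: ge0_ler_powR; rewrite ?subr_ge0 ?nnegrE ?(ltW x0) ?(ltW y0).
Qed.

End kernel.

(** * Dependence of the kernel on the order *)

Section order_dependence.
Local Opaque Gamma.
Context {R : realType}.
Notation mu := (@lebesgue_measure R).
Implicit Types a b c d u x y : R.

(** The derivative of [x `^ r] in [r] carries a factor [ln x].  It is absorbed by
    giving up half of the exponent near [0] and by adding to the exponent for
    large [x]; the remaining powers are integrable against [expR (- x)], and the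
    smaller one is still an admissible kernel. *)
Lemma powR_diff_le a d x : 0 < a -> 0 <= d <= 1 -> 0 < x ->
  `|x `^ (a + d - 1) - x `^ (a - 1)| <=
  d * (2 / a * x `^ (a / 2 - 1) + x `^ (a + 2 - 1)).
Proof.
move=> a0 /andP[d0 d1] x0.
have powE r : x `^ r = expR (r * ln x) by rewrite /powR gt_eqF.
have -> : a + d - 1 = (a - 1) + d by ring.
rewrite (@powRD _ x (a - 1) d) ?(gt_eqF x0) ?implybT// -{2}[x `^ (a - 1)]mulr1 -mulrBr normrM.
rewrite ger0_norm ?powR_ge0//.
have A0 : 0 <= 2 / a * x `^ (a / 2 - 1).
  by rewrite mulr_ge0 ?powR_ge0// divr_ge0// ltW.
have [x1|x1] := leP x 1.
  apply: (@le_trans _ _ (d * (2 / a * x `^ (a / 2 - 1)))); last first.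
    by rewrite ler_wpM2l// lerDl powR_ge0.
  have l0 : ln x <= 0 by exact: ln_le0.
  have xd1 : x `^ d <= 1.
    by rewrite powE -expR0 ler_expR mulr_ge0_le0.
  rewrite ler0_norm ?subr_le0// opprB.
  have h1 : 1 - x `^ d <= d * - ln x.
    by have := expR_ge1Dx (d * ln x); rewrite powE; lra.
  have h2 : - ln x <= 2 / a * x `^ (- (a / 2)).
    have : - (a / 2) * ln x <= x `^ (- (a / 2)).
      by rewrite powE; have := expR_ge1Dx (- (a / 2) * ln x); lra.
    rewrite -(@ler_pM2l _ (2 / a)) ?divr_gt0//; apply: le_trans.
    by rewrite le_eqVlt; apply/orP; left; apply/eqP; field; rewrite gt_eqF.
  apply: (@le_trans _ _ (x `^ (a - 1) * (d * (2 / a * x `^ (- (a / 2)))))).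
    rewrite ler_wpM2l ?powR_ge0//; apply: le_trans h1 _; exact: ler_wpM2l.
  have -> : a / 2 - 1 = (a - 1) + (- (a / 2)) by lra.
  rewrite (@powRD _ x (a - 1)) ?(gt_eqF x0) ?implybT//.
  by rewrite le_eqVlt; apply/orP; left; apply/eqP; ring.
apply: (@le_trans _ _ (d * x `^ (a + 2 - 1))); last by rewrite ler_wpM2l// lerDr.
have l0 : 0 <= ln x by apply: ln_ge0; exact: ltW.
have xd1 : 1 <= x `^ d by rewrite powE -expR0 ler_expR mulr_ge0.
rewrite ger0_norm ?subr_ge0//.
have h1 : x `^ d - 1 <= d * (x * x).
  have h : 1 - x `^ (- d) <= d * ln x.
    by have := expR_ge1Dx (- d * ln x); rewrite powE; lra.
  have -> : x `^ d - 1 = x `^ d * (1 - x `^ (- d)).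
    by rewrite mulrBr mulr1 -powRD ?(gt_eqF x0) ?implybT// subrr powRr0.
  have h2 : x `^ d <= x by rewrite -{2}(powRr1 (ltW x0)) ler_powR// ltW.
  have h3 : ln x <= x by have := ln_le_subr1 x0; lra.
  have h4 : 0 <= 1 - x `^ (- d).
    by rewrite subr_ge0 powE -expR0 ler_expR mulNr oppr_le0 mulr_ge0.
  apply: (@le_trans _ _ (x * (d * ln x))); first by rewrite ler_pM ?powR_ge0.
  by rewrite mulrCA ler_wpM2l// ler_wpM2l// ltW.
have -> : a + 2 - 1 = (a - 1) + 2 by ring.
rewrite (@powRD _ x (a - 1) 2) ?(gt_eqF x0) ?implybT// mulrCA ler_wpM2l ?powR_ge0//.
by rewrite [x `^ 2](_ : _ = x * x)// -expr2 -powR_mulrn// ltW.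
Qed.

(** The integral of the bound of [powR_diff_le] against [expR (- x)]. *)
Definition Gamma_slope a : R := 2 / a * Gamma (a / 2) + Gamma (a + 2).

Lemma Gamma_slope_ge0 a : 0 < a -> 0 <= Gamma_slope a.
Proof.
move=> a0; rewrite addr_ge0//; last by rewrite ltW// Gamma_gt0// addr_gt0.
by rewrite mulr_ge0 ?divr_ge0// ltW// Gamma_gt0// divr_gt0.
Qed.

Lemma Gamma_right_lipschitz a d : 0 < a -> 0 <= d <= 1 ->
  `|Gamma (a + d) - Gamma a| <= d * Gamma_slope a.
Proof.
move=> a0 d01; have /andP[d0 d1] := d01.
have ad0 : 0 < a + d by rewrite ltr_wpDr.
have a20 : 0 < a / 2 by rewrite divr_gt0.
have a2 : 0 < a + 2 by rewrite addr_gt0.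
have mD : measurable (`]0, +oo[%classic : set R) by exact: measurable_itv.
have iA c : 0 < c -> mu.-integrable `]0, +oo[ (EFin \o gamma_integrand c).
  exact: integrable_gamma.
have iZ := integrable_scale (2 / a) mD (iA _ a20).
have iB := integrable_sub mD (iA _ ad0) (iA _ a0).
have iS := integrable_add mD iZ (iA _ a2).
have -> : Gamma (a + d) - Gamma a =
    \int[mu]_(x in `]0, +oo[) (gamma_integrand (a + d) x - gamma_integrand a x).
  by rewrite (Rintegral_sub mD (iA _ ad0) (iA _ a0)).
have -> : Gamma_slope a = \int[mu]_(x in `]0, +oo[)
    (2 / a * gamma_integrand (a / 2) x + gamma_integrand (a + 2) x).
  by rewrite (Rintegral_add mD iZ (iA _ a2)) (Rintegral_scale _ mD (iA _ a20)).
rewrite -(Rintegral_scale d mD iS).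
apply: (Rintegral_norm_le mD iB (integrable_scale d mD iS)).
move=> x /=; rewrite in_itv/= andbT => x0.
rewrite /gamma_integrand -mulrBl normrM (ger0_norm (expR_ge0 _)) mulrA -mulrDl mulrA.
by rewrite ler_wpM2r ?expR_ge0// powR_diff_le.
Qed.

(** The rate at which [kern b] leaves [kern a] as [b] increases from [a]: the
    first two terms come from the power, the last one from the factor
    [(Gamma b)^-1]. *)
Definition order_slope a u : R := 2 / Gamma a *
  (2 / a * Gamma (a / 2) * kern (a / 2) u + Gamma (a + 2) * kern (a + 2) u +
   Gamma_slope a * kern a u).

(** The restriction on [d] keeps [Gamma (a + d)] above half of [Gamma a]. *)
Lemma kern_order_diff a d u : 0 < a -> 0 <= d <= 1 ->
  d * Gamma_slope a <= Gamma a / 2 ->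
  `|kern (a + d) u - kern a u| <= d * order_slope a u.
Proof.
move=> a0 d01 dG; have /andP[d0 d1] := d01.
have [u0|u0] := leP u 0.
  by rewrite /order_slope !kern_le0// subrr normr0 !(mulr0, addr0).
have Ga := Gamma_gt0 a0.
have Gb : Gamma a / 2 <= Gamma (a + d).
  have := le_trans (Gamma_right_lipschitz a0 d01) dG.
  by rewrite ler_norml => /andP[+ _]; lra.
have Gb0 : 0 < Gamma (a + d) by apply: lt_le_trans Gb; rewrite divr_gt0.
have Gh : 0 < Gamma (a / 2) by rewrite Gamma_gt0// divr_gt0.
have G2 : 0 < Gamma (a + 2) by rewrite Gamma_gt0// addr_gt0.
rewrite /order_slope !kern_gt0E//.
have lip := Gamma_right_lipschitz a0 d01.
have pq := powR_diff_le a0 d01 u0.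
have p0 : 0 <= u `^ (a - 1) by exact: powR_ge0.
move: (u `^ (a + d - 1)) (u `^ (a - 1)) (u `^ (a / 2 - 1)) (u `^ (a + 2 - 1)) p0 pq
  => q p r s p0 pq.
move: (Gamma_slope a) (Gamma a) (Gamma (a + d)) (Gamma (a / 2)) (Gamma (a + 2))
  Ga Gb Gb0 Gh G2 lip {dG} => S g g' gh g2 Ga Gb Gb0 Gh G2 lip.
have -> : q / g' - p / g = g'^-1 * ((q - p) + p / g * (g - g')).
  by field; rewrite !gt_eqF.
rewrite normrM gtr0_norm ?invr_gt0// mulrCA.
apply: ler_pM => //; first by rewrite invr_ge0 ltW.
  by rewrite ler_pdivlMr// mulrC ler_pdivrMr//; lra.
rewrite [leRHS]mulrDr; apply: le_trans (ler_normD _ _) _; apply: lerD.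
  apply: le_trans pq _; rewrite le_eqVlt; apply/orP; left; apply/eqP.
  by field; rewrite !gt_eqF.
have pg : 0 <= p / g by rewrite divr_ge0// ltW.
rewrite normrM distrC (ger0_norm pg) [leRHS]mulrA [leRHS]mulrC; exact: ler_wpM2l.
Qed.

End order_dependence.

(** * The Riemann-Liouville integral *)

Section continuity.
Context {R : realType}.

Lemma continuous_max0 : continuous (fun x : R => Num.max 0 x).
Proof. by move=> x; apply: continuous_max; [exact: cvg_cst|exact: cvg_id]. Qed.

Lemma continuous_powR_max0 (r : R) : 0 < r ->
  continuous (fun x : R => (Num.max 0 x) `^ r).
Proof.
move=> r0 x; have [x0|x0|x0] := ltgtP 0 (x : R).
- apply: (@continuous_comp R R R (fun x : R => Num.max 0 x) (fun y : R => y `^ r)).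
    exact: continuous_max0.
  by apply: continuous_powR; rewrite lt_max x0 orbT.
- rewrite /continuous_at max_l ?(ltW x0)// powR0 ?gt_eqF//.
  apply/cvgrPdist_lt => e e0; near=> y.
  rewrite max_l ?powR0 ?gt_eqF ?subrr ?normr0//.
  by near: y; apply: lt_le_nbhsl.
rewrite -x0 /continuous_at max_l// powR0 ?gt_eqF//.
apply/cvgrPdist_lt => e e0.
have [d /= d0 Hd] : \forall y \near 0^'+, y `^ r < e.
  by have /cvgr_lt /(_ _ e0) := powR_cvg0 r0; apply.
exists d => // y /=; rewrite !sub0r !normrN => yd.
have [y0|y0] := leP y 0; first by rewrite powR0 ?gt_eqF// normr0.
rewrite ger0_norm ?powR_ge0//; apply: Hd => //=.
by rewrite sub0r normrN.
Unshelve. all: by end_near. Qed.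

Lemma continuous_bounded (g : R -> R) (x : R) : continuous g ->
  exists2 M : R, 0 <= M & forall y : R, 0 <= y <= x -> `|g y| <= M.
Proof.
move=> cg; have [x0|x0] := leP 0 x; last first.
  by exists 0 => // y /andP[y0 yx]; lra.
have cng : {within `[0, x], continuous (fun y : R => `|g y|)}.
  by apply: continuous_subspaceT => y; apply: cvg_norm; exact: cg.
have [c _ Hc] := EVT_max x0 cng.
by exists `|g c| => // y yx; apply: Hc; rewrite in_itv.
Qed.

End continuity.

Section riemann_liouville.
Context {R : realType}.
Notation mu := (@lebesgue_measure R).
Implicit Types (a b d x y M : R) (g h : R -> R).
Local Opaque Gamma.

Lemma integrable_kern_kern a b x : 0 < a -> 0 < b ->
  mu.-integrable setT (EFin \o (fun y : R => kern a (x - y) * kern b y)).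
Proof.
move=> a0 b0; apply/integrableP; split.
  by apply/measurable_EFinP; exact: measurable_kern_kern.
under eq_integral => y _ do
  rewrite gee0_abs ?lee_fin ?mulr_ge0 ?kern_ge0//=.
by rewrite kern_conv// ltry.
Qed.

Lemma Rintegral_kern_kern a b x : 0 < a -> 0 < b ->
  \int[mu]_y (kern a (x - y) * kern b y) = kern (a + b) x.
Proof. by move=> a0 b0; rewrite /Rintegral kern_conv. Qed.

(** Cutting off at [0] on the left; [kern a (x - y)] cuts off at [x] on the
    right. *)
Definition causal g y : R := if 0 < y then g y else 0.

Definition RL a g x : R := \int[mu]_y (kern a (x - y) * causal g y).

Lemma measurable_causal g : continuous g -> measurable_fun setT (causal g).
Proof.
move=> cg; apply: measurable_fun_ifT => //; first exact: measurable_fun_ltr.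
exact: continuous_measurable_fun.
Qed.

Lemma measurable_RL a g x : continuous g ->
  measurable_fun setT (fun y : R => kern a (x - y) * causal g y).
Proof.
by move=> cg; apply: measurable_funM; [exact: measurable_kernB|exact: measurable_causal].
Qed.

Lemma kern_causal_le a g x y M : 0 < a -> (forall y, 0 < y < x -> `|g y| <= M) ->
  `|kern a (x - y) * causal g y| <= M * (kern a (x - y) * kern 1 y).
Proof.
move=> a0 gM; rewrite normrM (ger0_norm (kern_ge0 _ a0)) mulrCA /causal kern1.
case: ifPn => y0; last by rewrite normr0 !mulr0.
have [xy|xy] := leP x y; first by rewrite kern_le0 ?mul0r//; lra.
by rewrite mulr1 ler_wpM2l ?kern_ge0// gM// y0.
Qed.

Lemma integrable_RL a g x : 0 < a -> continuous g ->
  mu.-integrable setT (EFin \o (fun y : R => kern a (x - y) * causal g y)).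
Proof.
move=> a0 cg; have [M M0 gM] := @continuous_bounded R g x cg.
have ik := integrable_scale M measurableT (integrable_kern_kern x a0 ltr01).
apply: (integrable_le measurableT (measurable_RL a x cg) _ ik) => y _.
by apply: kern_causal_le => // z /andP[z0 zx]; apply: gM; rewrite !ltW.
Qed.

Lemma RL_le0 a g x : x <= 0 -> RL a g x = 0.
Proof.
move=> x0; rewrite /RL (@eq_Rintegral _ _ _ mu _ (fun=> 0)).
  by rewrite Rintegral_cst// mul0r.
move=> y _; rewrite /causal; case: ifPn => y0; last by rewrite mulr0.
by rewrite kern_le0 ?mul0r//; lra.
Qed.

Lemma eq_RL a g h x : (forall y, 0 < y < x -> g y = h y) -> RL a g x = RL a h x.
Proof.
move=> gh; apply: eq_Rintegral => y _; rewrite /causal; case: ifPn => // y0.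
have [xy|xy] := leP x y; first by rewrite kern_le0 ?mul0r//; lra.
by rewrite gh// y0.
Qed.

Lemma RL_bound a g x M : 0 < a -> continuous g ->
  (forall y, 0 < y < x -> `|g y| <= M) -> `|RL a g x| <= M * kern (a + 1) x.
Proof.
move=> a0 cg gM; have ik := integrable_kern_kern x a0 ltr01.
rewrite -(Rintegral_kern_kern _ a0 ltr01) -(Rintegral_scale M measurableT ik).
apply: (Rintegral_norm_le measurableT (integrable_RL x a0 cg) (integrable_scale M measurableT ik)).
by move=> y _; exact: kern_causal_le.
Qed.

Lemma RLB a g h x : 0 < a -> continuous g -> continuous h ->
  RL a (fun y => g y - h y) x = RL a g x - RL a h x.
Proof.
move=> a0 cg ch.
rewrite -(Rintegral_sub measurableT (integrable_RL x a0 cg) (integrable_RL x a0 ch)).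
apply: eq_Rintegral => y _; rewrite -mulrBr /causal; case: ifP => //.
by rewrite subrr.
Qed.

Lemma RL_cst a c x : 0 < a -> RL a (fun=> c) x = c * kern (a + 1) x.
Proof.
move=> a0; have ik := integrable_kern_kern x a0 ltr01.
rewrite -(Rintegral_kern_kern _ a0 ltr01) -(Rintegral_scale c measurableT ik).
apply: eq_Rintegral => y _; rewrite kern1 /causal; case: ifP => _.
  by rewrite mulr1 mulrC.
by rewrite !mulr0.
Qed.

Lemma Rintegral_reflect (f : R -> R) d : measurable_fun setT f ->
  \int[mu]_x f x = \int[mu]_x f (d - x).
Proof.
move=> mf; rewrite /Rintegral; congr fine; rewrite integralE [RHS]integralE.
have mr : measurable_fun setT (fun x : R => f (d - x)).
  by apply: measurableT_comp mf _; exact: measurable_funB.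
have N10 : (-1 : R) != 0 by rewrite oppr_eq0 oner_eq0.
have refl (p : R -> R) : measurable_fun setT p -> (forall x, 0 <= p x) ->
    (\int[mu]_x (p x)%:E = \int[mu]_x (p (d - x))%:E)%E.
  move=> mp p0; rewrite (ge0_integral_affine d N10 mp p0) normrN1 mul1e.
  by apply: eq_integral => x _; rewrite mulN1r addrC.
congr (_ - _)%E.
- transitivity (\int[mu]_x (Num.max (f x) 0)%:E)%E.
    by apply: eq_integral => x _; rewrite funeposE EFin_max.
  rewrite refl; last 2 first.
  + by apply: measurable_maxr.
  + by move=> x; rewrite le_max lexx orbT.
  by apply: eq_integral => x _; rewrite funeposE EFin_max.
- transitivity (\int[mu]_x (Num.max (- f x) 0)%:E)%E.
    by apply: eq_integral => x _; rewrite funenegE EFin_max.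
  rewrite refl; last 2 first.
  + by apply: measurable_maxr => //; exact: measurableT_comp.
  + by move=> x; rewrite le_max lexx orbT.
  by apply: eq_integral => x _; rewrite funenegE EFin_max.
Qed.

Lemma continuous_kern a : 1 < a -> continuous (kern a : R -> R).
Proof.
move=> a1; have a10 : 0 < a - 1 by rewrite subr_gt0.
rewrite (_ : kern a = fun x => (Num.max 0 x) `^ (a - 1) / Gamma a); last first.
  apply/funext => x; rewrite /kern; case: ltP => //= _.
  by rewrite powR0 ?mul0r// gt_eqF.
by move=> x; apply: cvgM; [exact: continuous_powR_max0|exact: cvg_cst].
Qed.

(** Once [g 0] is subtracted, the extension of [g] by zero is continuous.  After
    reflection the variable [x] only occurs in this factor, and dominated
    convergence applies; constants integrate to multiples of [kern (a + 1)]. *)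
Lemma RL_continuous a g : 0 < a -> continuous g -> continuous (RL a g).
Proof.
move=> a0 cg; pose g0 y := g y - g 0.
have cg0 : continuous g0 by move=> y; apply: cvgB; [exact: cg|exact: cvg_cst].
have cc0 : continuous (causal g0).
  rewrite (_ : causal g0 = g0 \o (fun x => Num.max 0 x)).
    move=> y; apply: continuous_comp; [exact: continuous_max0|exact: cg0].
  apply/funext => y; rewrite /causal /=; case: ltP => // _.
  by rewrite /g0 subrr.
suff cRL : continuous (RL a g0).
  rewrite (_ : RL a g = fun x => RL a g0 x + g 0 * kern (a + 1) x); last first.
    apply/funext => x; rewrite RLB//; last by move=> y; exact: cvg_cst.
    by rewrite RL_cst// subrK.
  move=> x; apply: cvgD; first exact: cRL.
  by apply: cvgM; [exact: cvg_cst|apply: continuous_kern; rewrite ltrDr].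
move=> x; pose v := x + 1.
have [M M0 gM] := @continuous_bounded R g0 v cg0.
have mf z : measurable_fun setT (fun u : R => kern a u * causal g0 (z - u)).
  apply: measurable_funM; first exact: measurable_kern.
  apply: measurableT_comp (measurable_causal cg0) _; exact: measurable_funB.
have RLE : RL a g0 = fun z => \int[mu]_(u in setT) (kern a u * causal g0 (z - u)).
  apply/funext => z; rewrite /RL (Rintegral_reflect z (measurable_RL a z cg0)).
  by apply: eq_Rintegral => u _; rewrite opprB addrC subrK.
have dom (z u : R) : z < v ->
    `|kern a u * causal g0 (z - u)| <= M * (kern 1 (v - u) * kern a u).
  move=> zv; have [u0|u0] := leP u 0; first by rewrite kern_le0// mul0r normr0 !mulr0.
  have := kern_ge0 u a0; move: (kern a u) => k k0.
  rewrite kern1 mulrA normrM (ger0_norm k0) mulrC ler_wpM2r// /causal.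
  case: ifPn => [zu|_]; last by rewrite normr0 mulr_ge0.
  have -> : (0 < v - u) = true by apply/idP; lra.
  by rewrite mulr1 gM//; apply/andP; split; lra.
have idom := integrable_scale M measurableT (integrable_kern_kern v ltr01 a0).
rewrite RLE; apply: (@continuity_under_integral R _ _ mu
    (fun z u => kern a u * causal g0 (z - u)) setT measurableT (x - 1) v _ _
    (fun u => M * (kern 1 (v - u) * kern a u)) idom) => //.
- move=> z; rewrite /= in_itv/= => /andP[_ zv].
  apply: (integrable_le measurableT (mf z) _ idom) => u _; exact: dom.
- apply: aeW => u _ z _; apply: cvgM; first exact: cvg_cst.
  apply: (@continuous_comp R R R (fun z : R => z - u) (causal g0)); last exact: cc0.
  by apply: cvgB; [exact: cvg_id|exact: cvg_cst].
- move=> z; rewrite /= in_itv/= => /andP[_ zv]; apply: aeW => u _; exact: dom.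
- by rewrite inE/= in_itv/=; apply/andP; split; rewrite /v; lra.
Qed.

Lemma causal_RL b g y : causal (RL b g) y = RL b g y.
Proof. by rewrite /causal; case: ltP => // y0; rewrite RL_le0. Qed.

(** By Fubini's theorem this is the convolution law of the kernels. *)
Lemma RL_semigroup a b g x : 0 < a -> 0 < b -> continuous g ->
  RL a (RL b g) x = RL (a + b) g x.
Proof.
move=> a0 b0 cg; have ab0 : 0 < a + b by rewrite addr_gt0.
pose h (p : measurableTypeR R * measurableTypeR R) : R :=
  kern a (x - p.1) * (kern b (p.1 - p.2) * causal g p.2).
have mh : measurable_fun setT h.
  apply: measurable_funM.
    by apply: measurableT_comp (measurable_kernB a x) _.
  apply: measurable_funM.
    by apply: measurableT_comp (measurable_kern b) _; exact: measurable_funB.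
  by apply: measurableT_comp (measurable_causal cg) _.
have hE (y z : R) : h (y, z) = causal g z * (kern a (x - y) * kern b (y - z)).
  by rewrite /h /= mulrA mulrC.
have ikk (z : R) : mu.-integrable setT
    (EFin \o (fun y : R => kern a (x - y) * kern b (y - z))).
  have mk : measurable_fun setT (fun y : R => kern a (x - y) * kern b (y - z)).
    apply: measurable_funM; first exact: measurable_kernB.
    by apply: measurableT_comp (measurable_kern b) _; exact: measurable_funB.
  apply/integrableP; split; first exact/measurable_EFinP.
  under eq_integral => y _ do
    rewrite gee0_abs ?lee_fin ?mulr_ge0 ?kern_ge0//=.
  by rewrite kern_conv_shift// ltry.
have ih : (mu \x mu)%E.-integrable setT (EFin \o h).
  apply/integrable21ltyP; first exact/measurable_EFinP.
  have ig := integrable_norm (integrable_RL x ab0 cg).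
  have : (\int[mu]_z (`|kern (a + b) (x - z) * causal g z|)%:E < +oo)%E.
    by apply: integrable_lty ig.
  apply: le_lt_trans; rewrite le_eqVlt; apply/orP; left; apply/eqP.
  apply: eq_integral => z _.
  transitivity (\int[mu]_y (`|causal g z| * (kern a (x - y) * kern b (y - z)))%:E)%E.
    apply: eq_integral => y _; rewrite /= hE normrM; congr (_ * _)%:E.
    by rewrite ger0_norm// mulr_ge0 ?kern_ge0.
  rewrite ge0_integral_mull; last 3 first.
  - exact: normr_ge0.
  - by have /integrableP[/measurable_EFinP] := ikk z.
  - by move=> y; rewrite mulr_ge0 ?kern_ge0.
  by rewrite kern_conv_shift// -EFinM normrM mulrC (ger0_norm (kern_ge0 _ ab0)).
rewrite /RL /Rintegral; congr fine.
transitivity (\int[mu]_y \int[mu]_z (EFin \o h) (y, z))%E.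
  apply: eq_integral => y _; rewrite causal_RL.
  rewrite -(Rintegral_scale _ measurableT (integrable_RL y b0 cg)) fineK//.
  apply: integrable_fin_num => //.
  exact: (integrable_scale _ measurableT (integrable_RL y b0 cg)).
etransitivity; first exact: (Fubini ih).
apply: eq_integral => z _.
transitivity ((\int[mu]_y (causal g z * (kern a (x - y) * kern b (y - z))))%:E).
  rewrite /Rintegral fineK.
    by apply: eq_integral => y _; rewrite /= hE.
  apply: integrable_fin_num => //.
  exact: (integrable_scale _ measurableT (ikk z)).
rewrite (Rintegral_scale _ measurableT (ikk z)) mulrC.
by rewrite /Rintegral kern_conv_shift.
Qed.

Lemma RL1E g x : continuous g -> RL 1 g x = \int[mu]_(y in `[0, x]) g y.
Proof.
move=> cg; have [x0|x0] := ltP x 0.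
  by rewrite RL_le0 ?(ltW x0)// set_itv_ge ?bnd_simp -?ltNge// Rintegral_set0.
have ig : mu.-integrable `[0, x] (EFin \o g).
  apply: continuous_compact_integrable; first exact: segment_compact.
  exact: continuous_subspaceT.
have mcc : measurable (`[0, x]%classic : set (measurableTypeR R)).
  exact: measurable_itv.
have moc : measurable (`]0, x]%classic : set (measurableTypeR R)).
  exact: measurable_itv.
have moo : measurable (`]0, x[%classic : set (measurableTypeR R)).
  exact: measurable_itv.
rewrite -Rintegral_itv_obnd_cbnd; last first.
  by apply: (integrableS mcc moc _ ig); exact: subset_itv_oc_cc.
rewrite -Rintegral_itv_bndo_bndc; last first.
  by apply: (integrableS mcc moo _ ig); exact: subset_itv_oo_cc.
rewrite [RHS]Rintegral_mkcond; apply: eq_Rintegral => y _.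
rewrite patchE mem_setE in_itv/= kern1 subr_gt0 /causal.
by case: (0 < y); case: (y < x); rewrite /= ?(mul1r, mul0r, mulr0).
Qed.

Lemma RL1_derive g x : continuous g -> 0 < x -> is_derive x 1 (RL 1 g) (g x).
Proof.
move=> cg x0; have xu : x < x + 1 by rewrite ltrDl.
have ig : mu.-integrable `[0, x + 1] (EFin \o g).
  apply: continuous_compact_integrable; first exact: segment_compact.
  exact: continuous_subspaceT.
have [dF FE] := continuous_FTC1_closed xu ig x0 (cg x).
rewrite (_ : RL 1 g = fun x => \int[mu]_(y in `[0, x]) g y).
  by split; [exact: dF|rewrite -derive1E; exact: FE].
by apply/funext => y; exact: (RL1E y cg).
Qed.

(** The semigroup law splits off one ordinary integration. *)
Lemma RL_derive a g x : 0 < a -> continuous g -> 0 < x ->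
  is_derive x 1 (RL (a + 1) g) (RL a g x).
Proof.
move=> a0 cg x0; rewrite (_ : RL (a + 1) g = RL 1 (RL a g)).
  by apply: RL1_derive => //; exact: RL_continuous.
by apply/funext => y; rewrite (RL_semigroup y ltr01 a0 cg) addrC.
Qed.

(** The integral of [order_slope a] over [0, x]: by the convolution law with
    [kern 1] each kernel gains one order. *)
Definition order_slope_int a x : R := 2 / Gamma a *
  (2 / a * Gamma (a / 2) * kern (a / 2 + 1) x + Gamma (a + 2) * kern (a + 2 + 1) x +
   Gamma_slope a * kern (a + 1) x).

Local Opaque kern.

Let kern_causal_order_diff a d g x y M : 0 < a -> 0 <= d <= 1 ->
  d * Gamma_slope a <= Gamma a / 2 ->
  (forall y, 0 < y < x -> `|g y| <= M) ->
  `|kern (a + d) (x - y) * causal g y - kern a (x - y) * causal g y| <=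
  M * d * (2 / Gamma a *
    (2 / a * Gamma (a / 2) * (kern (a / 2) (x - y) * kern 1 y) +
     Gamma (a + 2) * (kern (a + 2) (x - y) * kern 1 y) +
     Gamma_slope a * (kern a (x - y) * kern 1 y))).
Proof.
move=> a0 d01 dG gM; rewrite -mulrBl /causal kern1.
case: ifPn => y0; last by rewrite !(mulr0, addr0) normr0.
rewrite !mulr1; have [xy|xy] := leP x y.
  by rewrite !kern_le0 ?(subrr, mul0r, mulr0, addr0, normr0)//; lra.
rewrite normrM -/(order_slope a (x - y)) [M * d]mulrC mulrAC.
by apply: ler_pM => //; [exact: kern_order_diff|apply: gM; rewrite y0].
Qed.

Lemma RL_order_diff a d g x M : 0 < a -> 0 <= d <= 1 ->
  d * Gamma_slope a <= Gamma a / 2 -> continuous g -> 0 <= M ->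
  (forall y, 0 < y < x -> `|g y| <= M) ->
  `|RL (a + d) g x - RL a g x| <= M * d * order_slope_int a x.
Proof.
move=> a0 d01 dG cg M0 gM; have /andP[d0 _] := d01.
have ad0 : 0 < a + d by rewrite ltr_wpDr.
have a20 : 0 < a / 2 by rewrite divr_gt0.
have a2 : 0 < a + 2 by rewrite addr_gt0.
have ik c : 0 < c -> mu.-integrable setT (EFin \o (fun y : R => kern c (x - y) * kern 1 y)).
  by move=> c0; exact: integrable_kern_kern.
have mT := @measurableT _ (measurableTypeR R).
have i1 := integrable_scale (2 / a * Gamma (a / 2)) mT (ik _ a20).
have i2 := integrable_scale (Gamma (a + 2)) mT (ik _ a2).
have i3 := integrable_scale (Gamma_slope a) mT (ik _ a0).
have i12 := integrable_add mT i1 i2.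
have i123 := integrable_add mT i12 i3.
have iS := integrable_scale (2 / Gamma a) mT i123.
have iM := integrable_scale (M * d) mT iS.
rewrite -(Rintegral_sub mT (integrable_RL x ad0 cg) (integrable_RL x a0 cg)).
rewrite /order_slope_int -!(Rintegral_kern_kern _ _ ltr01)//.
rewrite -(Rintegral_scale _ mT (ik _ a20)) -(Rintegral_scale _ mT (ik _ a2)).
rewrite -(Rintegral_scale _ mT (ik _ a0)).
rewrite -(Rintegral_add mT i1 i2) -(Rintegral_add mT i12 i3).
rewrite -(Rintegral_scale _ mT i123) -(Rintegral_scale _ mT iS).
have iB := integrable_sub mT (integrable_RL x ad0 cg) (integrable_RL x a0 cg).
by apply: (Rintegral_norm_le mT iB iM) => y _; exact: kern_causal_order_diff.
Qed.

End riemann_liouville.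

(** * Volterra equations on a short interval *)

Section volterra.
Context {R : realType}.
Implicit Types (a x y : R) (g w T : R -> R).
Local Opaque Gamma.

(** The intervals of radius [2 * B / 2 ^+ k] around [u k] are nested, so the
    supremum of their left ends belongs to all of them. *)
Lemma geometric_limit (u : nat -> R) (B : R) :
  (forall k, `|u k.+1 - u k| <= B / 2 ^+ k) ->
  exists l, forall k, `|l - u k| <= 2 * B / 2 ^+ k.
Proof.
move=> uB; pose e k : R := 2 * B / 2 ^+ k.
have B0 : 0 <= B by apply: le_trans (normr_ge0 _) (_ : `|u 1%N - u 0%N| <= _); rewrite -[B]divr1 -[1](expr0 2).
have eS k : e k = 2 * e k.+1.
  by rewrite /e exprS; field; rewrite expf_neq0.
have e0 k : 0 <= e k by rewrite divr_ge0 ?mulr_ge0 ?exprn_ge0.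
have eB k : B / 2 ^+ k = e k.+1.
  by rewrite /e exprS; field; rewrite expf_neq0.
have lo k n : u k - e k <= u (k + n)%N - e (k + n)%N.
  elim: n => [|n IH]; first by rewrite addn0.
  apply: le_trans IH _; rewrite addnS; have := uB (k + n)%N.
  by rewrite eB (eS (k + n)%N) ler_norml => /andP[? ?]; lra.
have hi k n : u (k + n)%N + e (k + n)%N <= u k + e k.
  elim: n => [|n IH]; first by rewrite addn0.
  apply: le_trans _ IH; rewrite addnS; have := uB (k + n)%N.
  by rewrite eB (eS (k + n)%N) ler_norml => /andP[? ?]; lra.
have lohi j k : u j - e j <= u k + e k.
  apply: le_trans (lo j k) _; apply: le_trans _ (hi k j); rewrite addnC.
  by have := e0 (k + j)%N; lra.
pose A : set R := range (fun k => u k - e k).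
have A0 : A !=set0 by exists (u 0%N - e 0%N); exists 0%N.
exists (sup A) => k; rewrite ler_norml -/(e k); apply/andP; split.
  have : u k - e k <= sup A.
    apply: sup_upper_bound; last by exists k.
    by split => //; exists (u 0%N + e 0%N) => _ [j _ <-]; exact: lohi.
  by lra.
have : sup A <= u k + e k by apply: ge_sup => // _ [j _ <-]; exact: lohi.
by lra.
Qed.

Lemma exp2_small (C e : R) : 0 < e -> exists k : nat, C / 2 ^+ k < e.
Proof.
move=> e0; pose k := (Num.truncn (`|C| / e)).+1; exists k.
rewrite ltr_pdivrMr ?exprn_gt0//; apply: le_lt_trans (ler_norm C) _.
rewrite mulrC -ltr_pdivrMr//; apply: (@lt_trans _ _ k%:R); first exact: truncnS_gt.
by rewrite -natrX ltr_nat ltn_expl.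
Qed.

Lemma uniform_geometric_continuous (w : nat -> R -> R) (g : R -> R) (C : R) :
  (forall k, continuous (w k)) ->
  (forall k x, `|g x - w k x| <= C / 2 ^+ k) -> continuous g.
Proof.
move=> cw wg x; apply/cvgrPdist_lt => e e0.
have e3 : 0 < e / 3 by rewrite divr_gt0.
have [k Hk] := exp2_small C e3.
have /cvgrPdist_lt /(_ _ e3) Hc := cw k x.
near=> y.
have h1 := le_lt_trans (wg k x) Hk; have h2 := le_lt_trans (wg k y) Hk.
have h3 : `|w k x - w k y| < e / 3 by near: y; exact: Hc.
rewrite (_ : g x - g y = (g x - w k x) + (w k x - w k y) - (g y - w k y)); last by ring.
move: h1 h2 h3; rewrite !ltr_norml => /andP[? ?] /andP[? ?] /andP[? ?].
by apply/andP; split; lra.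
Unshelve. all: by end_near. Qed.

(** The continuity of the right-hand side in the form in which Picard iteration
    uses it. *)
Definition superposes (F : R -> R -> R) : Prop :=
  forall g, continuous g -> continuous (fun x => F x (g x)).

Definition rlipschitz (L : R) (F : R -> R -> R) : Prop :=
  forall x y y', `|F x y - F x y'| <= L * `|y - y'|.

(** The integral operator on [0, X] has norm [kern (a + 1) X], so the superposed
    operator is a contraction with factor 1/2. *)
Lemma RL_lipschitz (F : R -> R -> R) (L a X D x : R) w w' :
  superposes F -> rlipschitz L F -> 0 <= L -> 0 < a ->
  continuous w -> continuous w' -> L * kern (a + 1) X <= 2^-1 -> 0 <= D ->
  0 <= x <= X -> (forall y, 0 < y < x -> `|w y - w' y| <= D) ->
  `|RL a (fun y => F y (w y)) x - RL a (fun y => F y (w' y)) x| <= D / 2.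
Proof.
move=> sF LF L0 a0 cw cw' LX D0 /andP[x0 xX] wD.
rewrite -RLB//; [|exact: sF|exact: sF].
have := @RL_bound R a (fun y => F y (w y) - F y (w' y)) x (L * D) a0.
have -> : D / 2 = 2^-1 * D by rewrite mulrC.
move=> H; apply: le_trans (H _ _) _.
- by move=> y; apply: cvgB; exact: sF.
- by move=> y yx; apply: le_trans (LF _ _ _) _; rewrite ler_wpM2l// wD.
- rewrite mulrAC ler_wpM2r//; apply: le_trans LX; rewrite ler_wpM2l//.
  by apply: kern_homo => //; rewrite lerDr ltW.
Qed.

(** Picard iteration.  The iterates are evaluated at the projection of the
    argument onto [0, X], which makes the estimates uniform on the line. *)
Lemma volterra_exists (F : R -> R -> R) (L a X : R) T :
  superposes F -> rlipschitz L F -> 0 <= L -> 0 < a -> 0 < X ->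
  L * kern (a + 1) X <= 2^-1 -> continuous T ->
  exists2 w : R -> R, continuous w & forall x, 0 <= x <= X ->
    w x = T x + RL a (fun y => F y (w y)) x.
Proof.
move=> sF LF L0 a0 X0 LX cT.
pose clip x := Num.min (Num.max 0 x) X.
have clipE x : 0 <= x <= X -> clip x = x.
  by move=> /andP[x0 xX]; rewrite /clip max_r// min_l.
have clip_in x : 0 <= clip x <= X.
  by rewrite /clip le_min ge_min lexx orbT le_max lexx (ltW X0).
have cclip : continuous clip.
  move=> x; apply: continuous_min; last exact: cvg_cst.
  exact: continuous_max0.
pose S w x := T x + RL a (fun y => F y (w y)) x.
have cS w : continuous w -> continuous (S w).
  move=> cw x; apply: cvgD; first exact: cT.
  by apply: RL_continuous => //; exact: sF.
pose op w x := S w (clip x).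
have cop w : continuous w -> continuous (op w).
  move=> cw x; apply: (@continuous_comp R R R clip (S w)); first exact: cclip.
  exact: cS.
have op_contr (w w' : R -> R) (D : R) : continuous w -> continuous w' -> 0 <= D ->
    (forall x, `|w x - w' x| <= D) -> forall x, `|op w x - op w' x| <= D / 2.
  move=> cw cw' D0 wD x; rewrite /op /S opprD addrACA subrr add0r.
  apply: (RL_lipschitz sF LF L0 a0 cw cw' LX D0 (clip_in x)) => y _; exact: wD.
pose w k := iter k op (fun=> 0).
have cw k : continuous (w k).
  by elim: k => [|k IH]; [move=> x; exact: cvg_cst|exact: cop].
have [B B0 HB] := @continuous_bounded R (S (w 0%N)) X (cS _ (cw 0%N)).
have wB k x : `|w k.+1 x - w k x| <= B / 2 ^+ k.
  elim: k x => [|k IH] x; first by rewrite subr0 expr0 divr1; exact: HB.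
  rewrite exprSr invfM mulrA; apply: (op_contr _ _ _ (cw k.+1) (cw k) _ IH).
  by rewrite divr_ge0 ?exprn_ge0.
have [g gw] : {g : R -> R & forall x k, `|g x - w k x| <= 2 * B / 2 ^+ k}.
  apply: (@choice _ _ (fun x l => forall k, `|l - w k x| <= 2 * B / 2 ^+ k)) => x.
  by apply: geometric_limit => k; exact: wB.
have cg : continuous g.
  by apply: (@uniform_geometric_continuous w g (2 * B)) => // k x; exact: gw.
exists g => // x x_in.
suff H k : `|g x - S g x| <= 4 * B / 2 ^+ k.
  have [e0|] := ltP 0 `|g x - S g x|.
    by have [k /lt_le_trans /(_ (H k))] := exp2_small (4 * B) e0; rewrite ltxx.
  by rewrite normr_le0 subr_eq0 => /eqP.
have h1 : `|op g x - op (w k) x| <= (2 * B / 2 ^+ k) / 2.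
  apply: (op_contr _ _ _ cg (cw k) _ (fun y => gw y k)).
  by rewrite divr_ge0 ?mulr_ge0 ?exprn_ge0.
have h2 : `|g x - w k.+1 x| <= (2 * B / 2 ^+ k) / 2.
  by rewrite -mulrA -invfM -exprSr; exact: gw.
have : op g x = S g x by rewrite /op clipE.
have wS : w k.+1 x = op (w k) x by [].
move: h1 h2; rewrite wS !ler_norml => /andP[? ?] /andP[? ?] <-.
have -> : 4 * B / 2 ^+ k = 2 * B / 2 ^+ k + 2 * B / 2 ^+ k by ring.
by apply/andP; split; lra.
Qed.

(** Where [`|w - w'|] is largest, the integral terms differ by at most half of
    that maximum, so the residuals control the other half. *)
Lemma volterra_stability (F : R -> R -> R) (L a X D : R) w w' :
  superposes F -> rlipschitz L F -> 0 <= L -> 0 < a -> 0 <= X ->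
  L * kern (a + 1) X <= 2^-1 -> continuous w -> continuous w' ->
  (forall x, 0 <= x <= X ->
     `|(w x - RL a (fun y => F y (w y)) x) -
       (w' x - RL a (fun y => F y (w' y)) x)| <= D) ->
  forall x, 0 <= x <= X -> `|w x - w' x| <= 2 * D.
Proof.
move=> sF LF L0 a0 X0 LX cw cw' wD.
have cd : {within `[0, X], continuous (fun x : R => `|w x - w' x|)}.
  by apply: continuous_subspaceT => y; apply: cvg_norm; apply: cvgB; [exact: cw|exact: cw'].
have [c cX Hc] := EVT_max X0 cd.
have {}cX : 0 <= c <= X by rewrite in_itv in cX.
have h : `|RL a (fun y => F y (w y)) c - RL a (fun y => F y (w' y)) c| <= `|w c - w' c| / 2.
  apply: (RL_lipschitz sF LF L0 a0 cw cw' LX _ cX) => // y /andP[y0 yc]; apply: Hc.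
  by rewrite in_itv/= ltW//= (le_trans (ltW yc))//; case/andP: cX.
move=> x xX; apply: le_trans (Hc x _) _; first by rewrite in_itv.
have := wD c cX; move: h; set r := RL _ _ _; set r' := RL _ _ _ => h k.
have : `|w c - w' c| <= `|(w c - r) - (w' c - r')| + `|r - r'|.
  apply: le_trans (ler_normD _ _); rewrite le_eqVlt; apply/orP; left; apply/eqP.
  by congr (`|_|); ring.
by lra.
Qed.

End volterra.

(** * Chains of derivatives and Taylor polynomials *)

Section derivative_chains.
Context {R : realType}.
Implicit Types (V U : nat -> R -> R) (X x y e : R) (n k : nat).

Lemma is_derive_add (f g : R -> R) x df dg : is_derive x 1 f df ->
  is_derive x 1 g dg -> is_derive x 1 (fun y => f y + g y) (df + dg).
Proof. exact: is_deriveD. Qed.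

Lemma is_derive_mul (f g : R -> R) x df dg : is_derive x 1 f df ->
  is_derive x 1 g dg -> is_derive x 1 (fun y => f y * g y) (f x * dg + g x * df).
Proof. exact: is_deriveM. Qed.

Lemma is_derive_scale (c : R) (f : R -> R) x df : is_derive x 1 f df ->
  is_derive x 1 (fun y => c * f y) (c * df).
Proof. exact: is_deriveZ. Qed.

Lemma is_derive_pow n x : is_derive x 1 (fun y : R => y ^+ n) (n%:R * x ^+ n.-1).
Proof.
have := @is_deriveX R R id n x 1 1 (is_derive_id x 1).
rewrite (_ : _ *: _ = n%:R * x ^+ n.-1); last by rewrite /GRing.scale/= mulr1.
by rewrite (_ : (id ^+ n)%R = fun y : R => y ^+ n)//; apply/funext => y; rewrite fctE.
Qed.

(** A function with [n] derivatives is handled as the sequence of these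
    derivatives, which avoids iterated derivative operators. *)
Definition deriv_chain X n V : Prop := forall k x, (k < n)%N -> 0 < x < X ->
  is_derive x 1 (V k) (V k.+1 x).

Lemma deriv_chainS X n V : deriv_chain X n.+1 V -> deriv_chain X n (fun k => V k.+1).
Proof. by move=> cV k x kn; exact: cV. Qed.

Lemma MVT_oo (f df : R -> R) X y x : (forall z, 0 < z < X -> is_derive z 1 f (df z)) ->
  0 < y -> y < x -> x < X -> exists2 c, y < c < x & f x - f y = df c * (x - y).
Proof.
move=> fd y0 yx xX.
have in_oo z : z \in `]y, x[ -> 0 < z < X.
  by rewrite in_itv/= => /andP[yz zx]; rewrite (lt_trans y0 yz) (lt_trans zx xX).
have fc : {within `[y, x], continuous f}.
  apply: continuous_in_subspaceT => z /set_mem /=; rewrite in_itv/= => /andP[yz zx].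
  apply: differentiable_continuous; apply/derivable1_diffP.
  have z_in : 0 < z < X by rewrite (lt_le_trans y0 yz) (le_lt_trans zx xX).
  by have [] := fd z z_in.
have [c c_in ->] := MVT yx (fun z zin => fd z (in_oo z zin)) fc.
by exists c => //; move: c_in; rewrite in_itv.
Qed.

Lemma zero_derive_cst (f : R -> R) X x y : (forall z, 0 < z < X -> is_derive z 1 f 0) ->
  0 < x < X -> 0 < y < X -> f x = f y.
Proof.
move=> fd; wlog xy : x y / x < y.
  move=> H xX yX; have [xy|yx|->//] := ltgtP x y; first exact: H.
  by apply/esym/H.
move=> /andP[x0 xX] /andP[y0 yX].
have [c _ /eqP] := MVT_oo fd x0 xy yX.
by rewrite mul0r subr_eq0 => /eqP.
Qed.

(** The bound on [U n] is integrated [n] times by the mean value theorem; the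
    vanishing limits at [0] remove the constants of integration. *)
Lemma chain_small X n U e : deriv_chain X n U ->
  (forall k, (k < n)%N -> U k x @[x --> 0^'+] --> 0) ->
  (forall x, 0 < x < X -> `|U n x| <= e) ->
  forall x, 0 < x < X -> `|U 0%N x| <= e * x ^+ n.
Proof.
elim: n U => [|n IH] U cU U0 Ue x xX; first by rewrite expr0 mulr1 Ue.
have U1 : forall z, 0 < z < X -> `|U 1%N z| <= e * z ^+ n.
  apply: (IH (fun k => U k.+1)) => //; first exact: deriv_chainS.
  by move=> k kn; apply: U0.
have /andP[x0 xX'] := xX.
have e0 : 0 <= e by apply: le_trans (Ue x xX).
apply/ler_addgt0Pr => d d0.
have [r /= r0 Hr] : \forall y \near 0^'+, `|U 0%N y| < d.
  by have /cvgr0Pnorm_lt /(_ _ d0) := U0 0%N isT; apply.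
pose y := Num.min (r / 2) (x / 2).
have y0 : 0 < y by rewrite lt_min !divr_gt0.
have yr : y < r by rewrite gt_min; apply/orP; left; lra.
have yx : y < x by rewrite gt_min; apply/orP; right; lra.
have Uy : `|U 0%N y| < d.
  by apply: Hr => //=; rewrite sub0r normrN gtr0_norm.
have [c /andP[yc cx] E] := MVT_oo (fun z => cU 0%N z isT) y0 yx xX'.
have c_in : 0 < c < X by rewrite (lt_trans y0 yc) (lt_trans cx xX').
rewrite -[U 0%N x](subrK (U 0%N y)); apply: le_trans (ler_normD _ _) _.
apply: lerD; last exact: ltW.
rewrite E normrM exprSr mulrA; apply: ler_pM => //.
  apply: le_trans (U1 c c_in) _; rewrite ler_wpM2l//.
  by rewrite lerXn2r ?nnegrE ?ltW//; case/andP: c_in.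
by rewrite gtr0_norm ?subr_gt0// lerBlDr lerDl ltW.
Qed.

(** A function with vanishing [n.+1]st derivative is a polynomial of degree at
    most [n]; being negligible before [x ^+ n] at [0] it must vanish.  The
    induction removes the term of degree [n] by comparing [V (2 * x)] with
    [2 ^+ n * V x]. *)
Lemma chain_zero X n V : deriv_chain X n.+1 V ->
  (forall x, 0 < x < X -> V n.+1 x = 0) ->
  (forall e, 0 < e -> exists2 d, 0 < d &
     forall x, 0 < x < X -> x < d -> `|V 0%N x| <= e * x ^+ n) ->
  forall x, 0 < x < X -> V 0%N x = 0.
Proof.
have half (Y z : R) (j : nat) : 0 < z < Y -> 0 < z / 2 ^+ j < Y.
  move=> /andP[z0 zY]; rewrite divr_gt0 ?exprn_gt0//= (le_lt_trans _ zY)//.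
  by rewrite ler_pdivrMr ?exprn_gt0// ler_pMr// exprn_ege1// ler1n.
elim: n X V => [|n IH] X V cV Vn Vo x xX.
  apply/eqP; rewrite -normr_le0; apply/ler_addgt0Pr => e e0; rewrite add0r.
  have [d d0 Hd] := Vo e e0; have [j xj] := exp2_small x d0.
  have y_in := half X x j xX.
  have V0 z : 0 < z < X -> is_derive z 1 (V 0%N) 0.
    by move=> z_in; rewrite -[0](Vn z z_in); exact: cV.
  rewrite (zero_derive_cst V0 xX y_in).
  by have := Hd _ y_in xj; rewrite expr0 mulr1.
pose U k x := 2 ^+ k * V k (2 * x) - 2 ^+ n.+1 * V k x.
have X2 y : 0 < y < X / 2 -> (0 < 2 * y < X) /\ (0 < y < X).
  by move=> /andP[? ?]; split; apply/andP; split; lra.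
have Vcst y z : 0 < y < X -> 0 < z < X -> V n.+1 y = V n.+1 z.
  apply: zero_derive_cst => w w_in; rewrite -[0](Vn w w_in); exact: cV.
have cU : deriv_chain (X / 2) n.+1 U.
  move=> k y kn /X2[y2 y1].
  have dV : is_derive (2 * y) 1 (V k) (V k.+1 (2 * y)) by apply: cV => //; exact: ltnW.
  have d1 := is_derive1_comp dV (is_derive_scale 2 (is_derive_id y 1)).
  have d2 : is_derive y 1 (V k) (V k.+1 y) by apply: cV => //; exact: ltnW.
  have := is_derive_add (is_derive_scale (2 ^+ k) d1)
    (is_derive_scale (- 2 ^+ n.+1) d2).
  rewrite /U [2 ^+ k.+1]exprSr -mulrA [2 * V _ _]mulrC mulr1 mulNr.
  by under [X in is_derive _ _ X _ -> _]eq_fun do rewrite mulNr.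
have /andP[x0 xX'] := xX.
have X0 : 0 < X by exact: lt_trans xX'.
have U0 y : 0 < y < X / 2 -> U 0%N y = 0.
  apply: (IH (X / 2) U cU).
    by move=> z /X2[z2 z1]; rewrite /U (Vcst _ _ z2 z1) subrr.
  move=> e e0; pose e' := e / (2 ^+ n.+2 * X).
  have e'0 : 0 < e' by rewrite divr_gt0// mulr_gt0// exprn_gt0.
  have [d d0 Hd] := Vo e' e'0; exists (d / 2); first by rewrite divr_gt0.
  move=> z zX zd; have [z2 z1] := X2 z zX; have /andP[z0 zX'] := z1.
  have h1 : `|V 0%N (2 * z)| <= e' * (2 * z) ^+ n.+1 by apply: Hd => //; lra.
  have h2 : `|V 0%N z| <= e' * z ^+ n.+1 by apply: Hd => //; lra.
  rewrite /U expr0 mul1r; apply: le_trans (ler_normB _ _) _.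
  rewrite normrM [`|2 ^+ _|]ger0_norm ?exprn_ge0//.
  apply: (@le_trans _ _ (e' * (2 * z) ^+ n.+1 + 2 ^+ n.+1 * (e' * z ^+ n.+1))).
    by apply: lerD => //; rewrite ler_wpM2l// exprn_ge0.
  have -> : e' * (2 * z) ^+ n.+1 + 2 ^+ n.+1 * (e' * z ^+ n.+1) =
      (e' * 2 ^+ n.+2 * z) * z ^+ n.
    by rewrite exprMn !exprS; ring.
  rewrite ler_wpM2r ?exprn_ge0 ?(ltW z0)//.
  apply: (@le_trans _ _ (e' * 2 ^+ n.+2 * X)).
    by rewrite ler_wpM2l ?(ltW zX')// mulr_ge0 ?exprn_ge0 ?(ltW e'0).
  by rewrite -[leLHS]mulrA /e' divfK// gt_eqF// mulr_gt0// exprn_gt0.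
have V2 j : V 0%N x = (2 ^+ n.+1) ^+ j * V 0%N (x / 2 ^+ j).
  elim: j => [|j ->]; first by rewrite !expr0 mul1r divr1.
  have E : x / 2 ^+ j = 2 * (x / 2 ^+ j.+1).
    by rewrite exprS; field; rewrite expf_neq0.
  have zX : 0 < x / 2 ^+ j.+1 < X / 2.
    have := half X x j xX; rewrite E => /andP[? ?].
    by apply/andP; split; lra.
  have := U0 _ zX; rewrite /U expr0 mul1r -E => /eqP; rewrite subr_eq0 => /eqP ->.
  by rewrite mulrA -exprSr.
apply/eqP; rewrite -normr_le0; apply/ler_addgt0Pr => e e0; rewrite add0r.
have e1 : 0 < e / x ^+ n.+1 by rewrite divr_gt0// exprn_gt0.
have [d d0 Hd] := Vo _ e1; have [j xj] := exp2_small x d0.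
rewrite (V2 j) normrM ger0_norm ?exprn_ge0//.
apply: (@le_trans _ _ ((2 ^+ n.+1) ^+ j * (e / x ^+ n.+1 * (x / 2 ^+ j) ^+ n.+1))).
  by rewrite ler_wpM2l ?exprn_ge0//; apply: Hd => //; exact: half.
rewrite expr_div_n -!exprM [(j * _)%N]mulnC.
rewrite le_eqVlt; apply/orP; left; apply/eqP.
field; rewrite !expf_neq0// gt_eqF//.
Qed.

Definition taylor (c : nat -> R) n x : R := \sum_(k < n) c k / (k`!)%:R * x ^+ k.

Lemma taylor_derive (c : nat -> R) n x :
  is_derive x 1 (taylor c n) (taylor (fun k => c k.+1) n.-1 x).
Proof.
elim: n => [|n IH].
  rewrite (_ : taylor c 0 = fun=> 0); last by apply/funext => y; rewrite /taylor big_ord0.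
  by rewrite /taylor big_ord0; exact: is_derive_cst.
rewrite (_ : taylor c n.+1 = fun y => taylor c n y + c n / (n`!)%:R * y ^+ n); last first.
  by apply/funext => y; rewrite /taylor big_ord_recr.
apply: (is_derive_eq (is_derive_add IH (is_derive_scale _ (is_derive_pow n x)))).
case: n {IH} => [|n]; first by rewrite /taylor !big_ord0 mul0r mulr0 addr0.
rewrite /taylor [RHS]big_ord_recr/=; congr (_ + _).
rewrite factS natrM mulrA; congr (_ * _).
by rewrite [n.+1%:R * _]mulrC invfM mulrA divfK// pnatr_eq0.
Qed.

Lemma taylor0 (c : nat -> R) n : (0 < n)%N -> taylor c n 0 = c 0%N.
Proof.
case: n => // n _; rewrite /taylor big_ord_recl expr0 mulr1 fact0 divr1 big1 ?addr0//.
by move=> i _; rewrite expr0n mulr0.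
Qed.

Lemma continuous_taylor (c : nat -> R) n : continuous (taylor c n).
Proof.
move=> x; apply/differentiable_continuous/derivable1_diffP.
by have [] := taylor_derive c n x.
Qed.

End derivative_chains.

(** * The substantial operators in the normalized variable *)

Section relative_derivative.
Context {R : realType}.
Implicit Types (A : set R) (g : R -> R) (t d h : R).

Lemma is_derive_quotientP g t d :
  is_derive t 1 g d <-> diff_quotient g t @ t^' --> d.
Proof.
have E (h : R) : h^-1 *: (g (h *: 1 + t) - g t) = diff_quotient g t (h + t).
  by rewrite /diff_quotient /GRing.scale/= mulr1 addrK mulrC.
split=> [[dg dE]|q].
  have : h^-1 *: (g (h *: 1 + t) - g t) @[h --> 0^'] --> d by rewrite -dE; exact: dg.
  move=> /cvgrPdist_lt H; apply/cvgrPdist_lt => e e0.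
  have [r /= r0 Hr] := H e e0.
  exists r => //= s ts st.
  have := Hr (s - t); rewrite /= sub0r opprB => /(_ ts).
  by rewrite subr_eq0 E subrK; apply.
have H : h^-1 *: (g (h *: 1 + t) - g t) @[h --> 0^'] --> d.
  apply/cvgrPdist_lt => e e0; move/cvgrPdist_lt : q => /(_ e e0) [r /= r0 Hr].
  exists r => // h /=; rewrite sub0r normrN => hr h0; rewrite E; apply: Hr => /=.
    by rewrite opprD addrCA subrr addr0 normrN.
  by rewrite -subr_eq0 addrK.
by split; [apply/cvg_ex; exists d; exact: H|apply: cvg_lim => //; exact: H].
Qed.

Lemma is_derive_diff_quotient A g t d :
  is_derive t 1 g d -> diff_quotient g t @ within A t^' --> d.
Proof.
move=> /is_derive_quotientP; apply: cvg_trans; apply: cvg_app.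
exact: cvg_within.
Qed.

Lemma derive_in_is_derive A g t : (\forall s \near t, A s) ->
  derivable_in A g t -> is_derive t 1 g (derive_in A g t).
Proof.
move=> At gt; apply/is_derive_quotientP.
apply: cvg_trans (gt); apply: cvg_app => P /= [r r0 Hr].
have [r' /= r'0 Hr'] := At.
exists (Num.min r r') => /=; first by rewrite lt_min r0.
by move=> s /=; rewrite lt_min => /andP[sr sr'] st; apply: Hr => //; exact: Hr'.
Qed.

(** Points of [`]0, h]] accumulate at [t] even at the end point [h], where they
    do so from the left. *)
Lemma within_itv_proper h t : 0 < t <= h -> ProperFilter (within `]0, h] t^').
Proof.
move=> /andP[t0 th]; apply: Build_ProperFilter_ex => P [r /= r0 Hr].
pose s := t - Num.min (r / 2) (t / 2).
have m0 : 0 < Num.min (r / 2) (t / 2) by rewrite lt_min !divr_gt0.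
have mt : Num.min (r / 2) (t / 2) <= t / 2 by rewrite ge_min lexx orbT.
have mr : Num.min (r / 2) (t / 2) <= r / 2 by rewrite ge_min lexx.
exists s; apply: Hr => /=.
- by rewrite /s opprB addrC subrK gtr0_norm//; lra.
- by rewrite /s -subr_eq0 addrC addKr oppr_eq0 gt_eqF.
- by rewrite in_itv/= /s; apply/andP; split; lra.
Qed.

(** The derivative at [t] only involves the values of [g] on [A] and at [t]. *)
Lemma derive_in_eq A g g' t d : ProperFilter (within A t^') -> A t ->
  (forall s, A s -> g s = g' s) -> is_derive t 1 g' d ->
  derivable_in A g t /\ derive_in A g t = d.
Proof.
move=> PF At gg' g'd.
have H : diff_quotient g t @ within A t^' --> d.
  apply: cvg_trans (is_derive_diff_quotient A g'd).
  apply: near_eq_cvg; exists 1 => //= s _ _ As.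
  by rewrite /diff_quotient !gg'.
by split; [apply/cvg_ex; exists d|apply: cvg_lim].
Qed.

End relative_derivative.

Section substantial_derivative.
Context {R : realType}.
Variables (sigma rho : R).
Hypothesis rho_gt0 : 0 < rho.
Implicit Types (h t x : R) (P : nat -> R -> R) (q J : R -> R).

Let rho_neq0 : rho != 0. Proof. by rewrite gt_eqF. Qed.

(** In the variable [x = t `^ rho] and after multiplication by
    [expR (sigma * x)] the substantial derivative is the ordinary one; [twist]
    undoes this normalization. *)
Definition twist (P : R -> R) t : R := expR (- sigma * t `^ rho) * P (t `^ rho).

Definition deriv_chain_pos n P : Prop := forall k x, (k < n)%N -> 0 < x ->
  is_derive x 1 (P k) (P k.+1 x).

Let powR_inv_mul t : 0 < t -> t `^ (1 - rho) * t `^ (rho - 1) = 1.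
Proof.
move=> t0; rewrite -powRD ?(gt_eqF t0) ?implybT//.
by rewrite (_ : _ + _ = 0) ?powRr0//; ring.
Qed.

Lemma twist_derive (P : R -> R) t p : 0 < t -> is_derive (t `^ rho) 1 P p ->
  is_derive t 1 (twist P)
   ((expR (- sigma * t `^ rho) * (p - sigma * P (t `^ rho))) * (rho * t `^ (rho - 1))).
Proof.
move=> t0 dP; have dr := is_derive1_powR rho t0.
have dE : is_derive (t `^ rho) 1 (fun x : R => expR (- sigma * x) * P x)
    (expR (- sigma * t `^ rho) * (p - sigma * P (t `^ rho))).
  have de := is_derive1_comp (is_derive_expR (- sigma * t `^ rho))
    (is_derive_scale (- sigma) (is_derive_id (t `^ rho) 1)).
  apply: (is_derive_eq (is_derive_mul de dP)) => /=; ring.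
exact: (@is_derive1_comp R (fun x : R => expR (- sigma * x) * P x)
  (fun s : R => s `^ rho) t _ _ dE dr).
Qed.

(** The weight [t `^ (1 - rho) / rho] cancels the derivative of [t `^ rho], and
    the summand [sigma * q t] cancels the derivative of the exponential. *)
Lemma sD1_twist h q (P : R -> R) t p : 0 < t <= h ->
  (forall s, 0 < s <= h -> q s = twist P s) -> is_derive (t `^ rho) 1 P p ->
  derivable_in `]0, h] q t /\ sD1 sigma rho `]0, h] q t = expR (- sigma * t `^ rho) * p.
Proof.
move=> th qP dP; have /andP[t0 _] := th.
have At : `]0, h]%classic t by rewrite /= in_itv.
have AP s : `]0, h]%classic s -> q s = twist P s by rewrite /= in_itv/=; exact: qP.
have [dq qE] := derive_in_eq (within_itv_proper th) At AP (twist_derive t0 dP).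
split=> //; rewrite /sD1 qE qP// /twist.
have := powR_inv_mul t0; move: (t `^ (1 - rho)) (t `^ (rho - 1)) => u v uv.
move: (expR _) (P _) => e y.
rewrite (_ : u / rho * (e * (p - sigma * y) * (rho * v)) =
  (u * v) * (e * (p - sigma * y))); last by field.
by rewrite uv; ring.
Qed.

Lemma sD_twist h n P q : deriv_chain_pos n P ->
  (forall t, 0 < t <= h -> q t = twist (P 0%N) t) ->
  forall k, (k <= n)%N -> forall t, 0 < t <= h ->
    sD_exists sigma rho `]0, h] k q t /\ sD sigma rho `]0, h] k q t = twist (P k) t.
Proof.
move=> cP qP; elim=> [|k IH] kn t th; first by split => //; exact: qP.
have {}IH s := IH (ltnW kn) s.
have /andP[t0 _] := th.
have dP : is_derive (t `^ rho) 1 (P k) (P k.+1 (t `^ rho)).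
  by apply: cP => //; exact: powR_gt0.
have [dq qE] := sD1_twist th (fun s sh => (IH s sh).2) dP.
split; last exact: qE.
split; last exact: dq.
by exists 1 => //= s _; rewrite in_itv/= => /IH[].
Qed.

Lemma sD_exists_le A k n J t : A t -> (k <= n)%N ->
  sD_exists sigma rho A n J t -> sD_exists sigma rho A k J t.
Proof.
move=> At; elim: n => [|n IH]; first by rewrite leqn0 => /eqP ->.
rewrite leq_eqVlt => /predU1P[->//|kn] [nJ _].
by apply: IH => //; have := nbhs_singleton nJ; exact.
Qed.

(** The normalization inverse to [twist], applied to a substantial derivative:
    the [k]-th ordinary derivative in the variable [x]. *)
Definition untwist h J k x : R :=
  expR (sigma * x) * sD sigma rho `]0, h] k J (x `^ rho^-1).

Lemma powR_invK t : 0 <= t -> (t `^ rho) `^ rho^-1 = t.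
Proof. by move=> t0; rewrite -powRrM divff// powRr1. Qed.

Lemma powR_Kinv x : 0 <= x -> (x `^ rho^-1) `^ rho = x.
Proof. by move=> x0; rewrite -powRrM mulVf// powRr1. Qed.

Lemma untwist_chain h d n J : 0 <= d <= h ->
  (forall t, 0 < t < d -> sD_exists sigma rho `]0, h] n J t) ->
  deriv_chain (d `^ rho) n (untwist h J).
Proof.
move=> /andP[d0 dh] nJ k x kn /andP[x0 xd]; pose t := x `^ rho^-1.
have t0 : 0 < t by exact: powR_gt0.
have td : t < d.
  rewrite -(powR_invK d0); apply: gt0_ltr_powR => //.
  - by rewrite invr_gt0.
  - by rewrite nnegrE ltW.
  - by rewrite nnegrE powR_ge0.
have th : t < h by exact: lt_le_trans dh.
have At : `]0, h]%classic t by rewrite /= in_itv/= t0 ltW.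
have [_ dJ] : sD_exists sigma rho `]0, h] k.+1 J t.
  by apply: (@sD_exists_le _ _ n) => //; apply: nJ; rewrite t0.
have At' : \forall s \near t, `]0, h]%classic s.
  near=> s; rewrite /= in_itv/=; apply/andP; split.
    by near: s; exact: lt_nbhsr.
  by near: s; exact: lt_le_nbhsl.
have dV := derive_in_is_derive At' dJ.
have dW := @is_derive1_comp R _ (fun x : R => x `^ rho^-1) x _ _ dV
  (is_derive1_powR rho^-1 x0).
have de := is_derive1_comp (is_derive_expR (sigma * x))
  (is_derive_scale sigma (is_derive_id x 1)).
apply: (is_derive_eq (is_derive_mul de dW)).
rewrite (_ : untwist h J k.+1 x = expR (sigma * x) *
  sD1 sigma rho `]0, h] (sD sigma rho `]0, h] k J) t); last by [].
rewrite /sD1 /= -/t.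
have -> : x `^ (rho^-1 - 1) = t `^ (1 - rho).
  by rewrite /t -powRrM mulrBr mulr1 mulVf.
by field.
Unshelve. all: by end_near. Qed.

End substantial_derivative.

Section substantial_integral.
Context {R : realType}.
Notation mu := (@lebesgue_measure R).
Variables (sigma rho : R).
Hypothesis rho_gt0 : 0 < rho.
Implicit Types (a t y s : R) (G psi : R -> R).
Local Opaque Gamma.

Let subst_ge0 a t G : 0 < a -> 0 < t -> continuous G ->
  (forall y, 0 < y < t `^ rho -> 0 <= G y) ->
  let H s := kern a (t `^ rho - s `^ rho) * G (s `^ rho) * (rho * s `^ (rho - 1)) in
  mu.-integrable `]0, t[ (EFin \o H) /\
  \int[mu]_(s in `]0, t[) H s = RL a G (t `^ rho).
Proof.
move=> a0 t0 cG G0 H; pose X := t `^ rho.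
have X0 : 0 < X by exact: powR_gt0.
pose K y := kern a (X - y) * G y.
have K0 : {in `]0, X[, forall y, 0 <= K y}.
  by move=> y; rewrite in_itv/= => yX; rewrite mulr_ge0 ?kern_ge0// G0.
have Kc : {in `]0, X[, continuous K}.
  move=> y; rewrite in_itv/= => /andP[y0 yX]; apply: cvgM; last exact: cG.
  have Xy : 0 < X - y by rewrite subr_gt0.
  have : (fun z : R => (X - z) `^ (a - 1) / Gamma a) z @[z --> y] -->
      (X - y) `^ (a - 1) / Gamma a.
    apply: cvgM; last exact: cvg_cst.
    apply: (@continuous_comp R R R (fun z : R => X - z) (fun z : R => z `^ (a - 1))).
      by apply: cvgB; [exact: cvg_cst|exact: cvg_id].
    exact: continuous_powR.
  rewrite -kern_gt0E//; apply: cvg_trans; apply: near_eq_cvg.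
  near=> z; rewrite kern_gt0E// subr_gt0.
  by near: z; exact: lt_nbhsl.
have iK := integrable_RL X a0 cG.
have KE : (\int[mu]_(y in `]0%R, X[) (K y)%:E = (RL a G X)%:E)%E.
  rewrite /RL /Rintegral fineK; last exact: integrable_fin_num.
  rewrite [LHS]integral_mkcond; apply: eq_integral => y _.
  rewrite patchE mem_setE in_itv/= /K /causal.
  case: ifPn => [/andP[-> _]//|].
  case: (ltP 0 y) => //= y0; last by rewrite mulr0.
  by rewrite -leNgt => Xy; rewrite kern_le0 ?mul0r// subr_le0.
have HE : (\int[mu]_(s in `]0%R, t[) (H s)%:E = (RL a G X)%:E)%E.
  by rewrite -KE (ge0_integral_subst_powR rho_gt0 t0 Kc K0).
have H0 s : `]0, t[%classic s -> 0 <= H s.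
  rewrite /= in_itv/= => /andP[s0 st].
  rewrite !mulr_ge0 ?kern_ge0 ?powR_ge0 ?(ltW rho_gt0)// G0//.
  rewrite powR_gt0//=; apply: gt0_ltr_powR => //; rewrite nnegrE ltW//.
have mH : measurable_fun `]0, t[ H.
  apply: measurable_funTS; apply: measurable_funM.
    apply: measurable_funM.
      apply: measurableT_comp (measurable_kern a) _; apply: measurable_funB.
        exact: measurable_cst.
      exact: measurable_powR.
    apply: (measurableT_comp (continuous_measurable_fun cG)).
    exact: measurable_powR.
  by apply: measurable_funM; [exact: measurable_cst|exact: measurable_powR].
split; last by rewrite /Rintegral HE.
apply/integrableP; split; first exact/measurable_EFinP.
rewrite (_ : (\int[mu]_(x in `]0%R, t[) `|(EFin \o H) x|)%E = (RL a G X)%:E) ?ltry//.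
rewrite -HE; apply: eq_integral => s /set_mem sin.
by rewrite /= ger0_norm// H0.
Unshelve. all: by end_near. Qed.

(** The substitution rule for nonnegative functions is applied to the constant
    [M] and to [M - G]. *)
Lemma Rintegral_subst a t G : 0 < a -> 0 < t -> continuous G ->
  let H s := kern a (t `^ rho - s `^ rho) * G (s `^ rho) * (rho * s `^ (rho - 1)) in
  mu.-integrable `]0, t[ (EFin \o H) /\
  \int[mu]_(s in `]0, t[) H s = RL a G (t `^ rho).
Proof.
move=> a0 t0 cG H; have [M M0 GM] := @continuous_bounded R G (t `^ rho) cG.
pose G' y := M - G y.
have cG' : continuous G' by move=> y; apply: cvgB; [exact: cvg_cst|exact: cG].
have cM : continuous (fun _ : R => M) by move=> y; exact: cvg_cst.
have mD : measurable (`]0, t[%classic : set (measurableTypeR R)) by exact: measurable_itv.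
have [i1 e1] := subst_ge0 a0 t0 cM (fun _ _ => M0).
have [|i2 e2] := subst_ge0 a0 t0 cG'.
  move=> y /andP[y0 yX]; rewrite subr_ge0; apply: le_trans (ler_norm _) _.
  by apply: GM; rewrite !ltW.
have HE : H = fun s => kern a (t `^ rho - s `^ rho) * M * (rho * s `^ (rho - 1)) -
   kern a (t `^ rho - s `^ rho) * G' (s `^ rho) * (rho * s `^ (rho - 1)).
  by apply/funext => s; rewrite /H -mulrBl -mulrBr /G' subKr.
have i12 := integrable_sub mD i1 i2.
split; first by rewrite HE.
rewrite HE (Rintegral_sub mD i1 i2) e1 e2 -(RLB _ a0 cM cG').
by congr RL; apply/funext => y; rewrite /G' subKr.
Qed.

(** Substituting [y = s `^ rho] turns the substantial integral into the
    Riemann-Liouville integral. *)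
Lemma sI_RL a t psi G : 0 < a -> 0 < t -> continuous G ->
  (forall s, 0 < s < t -> expR (sigma * s `^ rho) * psi s = G (s `^ rho)) ->
  sI_exists sigma rho a psi t /\ sI sigma rho a psi t = twist sigma rho (RL a G) t.
Proof.
move=> a0 t0 cG psiG; have [iH HE] := Rintegral_subst a0 t0 cG.
set H := (fun s : R => _) in iH HE.
have mcc : measurable (`[0, t]%classic : set (measurableTypeR R)) by exact: measurable_itv.
have moo : measurable (`]0, t[%classic : set (measurableTypeR R)) by exact: measurable_itv.
have moc : measurable (`]0, t]%classic : set (measurableTypeR R)) by exact: measurable_itv.
have rho_neq0 : rho != 0 by rewrite gt_eqF.
have Ga := Gamma_gt0 a0; pose c := Gamma a / rho * expR (- sigma * t `^ rho).
have SE s : `]0, t[%classic s -> sI_integrand sigma rho a psi t s = c * H s.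
  rewrite /= in_itv/= => /andP[s0 st].
  have ts : 0 < t `^ rho - s `^ rho.
    by rewrite subr_gt0; apply: gt0_ltr_powR => //; rewrite nnegrE ltW.
  rewrite /sI_integrand /H -psiG ?s0// kern_gt0E// /c.
  rewrite (_ : - sigma * (t `^ rho - s `^ rho) = - sigma * t `^ rho + sigma * s `^ rho);
    last by ring.
  rewrite expRD; move: (expR _) (expR _) (_ `^ (a - 1)) (s `^ (rho - 1)) (psi s).
  move: (Gamma a) Ga => g g0 e1 e2 p q r.
  by field; rewrite rho_neq0 gt_eqF.
have icH := integrable_scale c moo iH.
have iS : mu.-integrable `]0, t[ (EFin \o sI_integrand sigma rho a psi t).
  apply: (eq_integrable moo _ _ _ icH) => s /set_mem sin.
  by rewrite /= SE.
have iS' : mu.-integrable `[0, t] (EFin \o sI_integrand sigma rho a psi t).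
  have /integrableP[mS fS] := iS.
  have mS' : measurable_fun `[0, t] (EFin \o sI_integrand sigma rho a psi t).
    apply/emeasurable_fun_itv_obnd_cbndP/emeasurable_fun_itv_bndo_bndcP.
    exact: mS.
  apply/integrableP; split; first exact: mS'.
  rewrite -integral_itv_obnd_cbnd.
    rewrite -integral_itv_bndo_bndc; first exact: fS.
    apply: measurableT_comp => //; exact: mS.
  apply: measurableT_comp => //; apply: (measurable_funS mcc _ mS').
  exact: subset_itv_oc_cc.
split; first by move=> _; exact: iS'.
rewrite /sI gt_eqF// -Rintegral_itv_obnd_cbnd; last first.
  by apply: (integrableS mcc moc _ iS'); exact: subset_itv_oc_cc.
rewrite -Rintegral_itv_bndo_bndc; last exact: iS.
rewrite (_ : \int[mu]_(s in `]0, t[) sI_integrand sigma rho a psi t s =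
    \int[mu]_(s in `]0, t[) (c * H s)); last first.
  by apply: eq_Rintegral => s /set_mem; exact: SE.
rewrite (Rintegral_scale c moo iH) HE /twist /c.
move: (RL _ _ _) (expR _) (Gamma a) Ga => u v g g0.
by field; rewrite rho_neq0 gt_eqF.
Qed.

End substantial_integral.

(** * Caputo problems as Volterra equations *)

Section caputo_volterra.
Context {R : realType}.
Variables (sigma rho : R).
Hypothesis rho_gt0 : 0 < rho.
Implicit Types (gamma h t x : R) (b : nat -> R) (psi Phi : R -> R).
Local Opaque Gamma RL kern.
Local Notation twist := (twist sigma rho).

Let predz_nat (n : nat) : (0 < n)%N -> (n%:Z - 1)%R = n.-1%:Z.
Proof. by move=> n0; rewrite -[in LHS](prednK n0) -addn1 PoszD addrK. Qed.

Lemma nceilP gamma (n : nat) : n.-1%:R < gamma <= n%:R -> (0 < n)%N -> nceil gamma = n.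
Proof.
move=> /andP[n1 n2] n0; rewrite /nceil (_ : Num.ceil gamma = n%:Z)//.
apply/eqP; rewrite eq_le ceil_le_int n2/= -ltzD1 -ltrBlDr.
by rewrite predz_nat// ceil_gt_int.
Qed.

Lemma nceil_itv gamma : 0 < gamma ->
  (0 < nceil gamma)%N /\ (nceil gamma).-1%:R < gamma <= (nceil gamma)%:R.
Proof.
move=> g0; have c0 : 0 < Num.ceil gamma by rewrite ceil_gt_int.
have cE : ((nceil gamma)%:Z = Num.ceil gamma)%R by rewrite /nceil gez0_abs ?ltW.
have n0 : (0 < nceil gamma)%N by rewrite -ltz_nat cE.
split=> //; apply/andP; split; last first.
  by rewrite -[(_)%:R]/((nceil gamma)%:~R) cE ceil_ge.
by have := gt_pred_ceil gamma; rewrite -cE predz_nat.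
Qed.

(** The successive derivatives of the [n]-fold integral of [Phi]. *)
Definition RL_tower n Phi j x : R := if (j < n)%N then RL (n - j)%:R Phi x else Phi x.

Lemma RL_tower_chain n Phi : continuous Phi -> deriv_chain_pos n (RL_tower n Phi).
Proof.
move=> cP k x kn x0; rewrite /RL_tower kn.
have nk : (n - k)%:R = (n - k.+1)%:R + 1 :> R by rewrite natr1 subnSK.
case: ifPn => kn'.
  by rewrite nk; apply: RL_derive => //; rewrite ltr0n subn_gt0.
have -> : (n - k)%N = 1%N.
  by apply/eqP; rewrite eqn_leq subn_gt0 kn andbT leq_subLR addn1 leqNgt.
exact: RL1_derive.
Qed.

Lemma powR_rho_cvg0 : t `^ rho @[t --> 0^'+] --> (0 : R).
Proof. exact: powR_cvg0. Qed.

Lemma twist_cvg0 (P : R -> R) : continuous P -> twist P t @[t --> 0^'+] --> P 0.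
Proof.
move=> cP; rewrite -[P 0]mul1r -[1]expR0 -[in expR 0](mulr0 (- sigma)).
apply: cvgM.
  apply: (@cvg_comp _ _ _ (fun t => - sigma * t `^ rho) expR _ (nbhs (- sigma * 0))).
    by apply: cvgM; [exact: cvg_cst|exact: powR_rho_cvg0].
  exact: continuous_expR.
by apply: (@cvg_comp _ _ _ (fun t => t `^ rho) P _ (nbhs 0)); [exact: powR_rho_cvg0|exact: cP].
Qed.

Lemma near_at_right0 h : 0 < h -> \forall t \near (0 : R)^'+, 0 < t <= h.
Proof.
move=> h0; near=> t; apply/andP; split; first by near: t; exact: nbhs_right_gt.
by near: t; exact: nbhs_right_le.
Unshelve. all: by end_near. Qed.

Lemma sTaylor_twist A n b psi t :
  (forall k, (k < n)%N -> sD_at0 sigma rho A k psi = b k) ->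
  sTaylor sigma rho A n psi t = twist (taylor b n) t.
Proof.
move=> bE; rewrite /sTaylor /twist /taylor big_distrr/=; apply: eq_bigr => k _.
by rewrite bE// powRrM powR_mulrn ?powR_ge0// mulrC.
Qed.

Lemma RL0 a Phi : RL a Phi 0 = 0.
Proof. exact: RL_le0. Qed.

(** The derivatives of [taylor b n + RL gamma Phi] of order [j < n] are
    [taylor] of the shifted coefficients plus [RL (gamma - j) Phi]; they are
    continuous and take the value [b j] at [0].  After subtraction of the Taylor
    part, the integral of order [n - gamma] gives [RL n Phi] by the semigroup
    law, and its [n]-th derivative is [Phi]. *)
Theorem volterra_is_solution gamma h b H f Phi : 0 < gamma -> 0 < h ->
  continuous Phi ->
  let psi := twist (fun x => taylor b (nceil gamma) x + RL gamma Phi x) in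
  (forall t, 0 <= t <= h -> H (t, psi t)) ->
  (forall t, 0 < t <= h -> f (t, psi t) = twist Phi t) ->
  {within `[0, h], continuous psi} ->
  is_solution sigma rho gamma b H f h psi.
Proof.
move=> g0 h0 cP psi psiH psif psic; set n := nceil gamma in psi psiH psif psic *.
have [n0 /andP[ng gn]] := nceil_itv g0; rewrite -/n in n0 ng gn.
have gj (j : nat) : (j < n)%N -> 0 < gamma - j%:R.
  move=> jn; rewrite subr_gt0; apply: le_lt_trans ng.
  by rewrite ler_nat -ltnS prednK.
pose P j x := taylor (fun k => b (k + j)%N) (n - j) x + RL (gamma - j%:R) Phi x.
have cP' j : (j < n)%N -> continuous (P j).
  move=> jn x; apply: cvgD; first exact: continuous_taylor.
  by apply: RL_continuous => //; exact: gj.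
have P0 j : (j < n)%N -> P j 0 = b j.
  by move=> jn; rewrite /P taylor0 ?subn_gt0// RL0 addr0.
have chP : deriv_chain_pos n.-1 P.
  move=> k x kn x0; have kn' : (k.+1 < n)%N by rewrite -[n]prednK.
  apply: is_derive_add.
    have := taylor_derive (fun i => b (i + k)%N) (n - k) x.
    rewrite subnS (_ : (fun i => b (i.+1 + k)%N) = (fun i => b (i + k.+1)%N))//.
    by apply/funext => i; rewrite addSnnS.
  have -> : gamma - k%:R = gamma - k.+1%:R + 1 by rewrite -natr1; ring.
  by apply: RL_derive => //; exact: gj.
have psiP t : 0 < t <= h -> psi t = twist (P 0%N) t.
  move=> _; rewrite /psi /twist /P subn0 subr0; congr (_ * (taylor _ _ _ + _)).
  by apply/funext => k; rewrite addn0.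
have sDpsi k t : (k < n)%N -> 0 < t <= h ->
    sD_exists sigma rho `]0, h] k psi t /\ sD sigma rho `]0, h] k psi t = twist (P k) t.
  by move=> kn; apply: (sD_twist rho_gt0 chP psiP); rewrite -ltnS prednK.
have near_h := near_at_right0 h0.
have at0 k : (k < n)%N -> sD sigma rho `]0, h] k psi t @[t --> 0^'+] --> b k.
  move=> kn; rewrite -(P0 k kn); apply: cvg_trans (twist_cvg0 (cP' k kn)).
  apply: near_eq_cvg; apply: filterS near_h => t th.
  by have [_ ->] := sDpsi k t kn th.
have init k : (k < n)%N ->
    sD_at0_exists sigma rho `]0, h] k psi /\ sD_at0 sigma rho `]0, h] k psi = b k.
  move=> kn; split; last by apply: cvg_lim => //; exact: at0.
  split; last by apply/cvg_ex; exists (b k); exact: at0.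
  by apply: filterS near_h => t th; have [] := sDpsi k t kn th.
pose chi s := psi s - sTaylor sigma rho `]0, h] n psi s.
have chiE s : chi s = twist (RL gamma Phi) s.
  rewrite /chi (@sTaylor_twist _ _ b); last by move=> k /init[].
  by rewrite /psi /twist -mulrBr addrC addKr.
pose J := sI sigma rho (n%:R - gamma) chi.
have JE t : 0 < t <= h -> sI_exists sigma rho (n%:R - gamma) chi t /\
    J t = twist (RL_tower n Phi 0%N) t.
  move=> /andP[t0 th]; rewrite /RL_tower n0 subn0.
  have [ng0|ng0] := eqVneq (n%:R - gamma) 0.
    split; first by rewrite /sI_exists ng0 eqxx.
    have nE : n%:R = gamma by apply/eqP; rewrite -subr_eq0 ng0.
    by rewrite /J /sI ng0 eqxx chiE nE.
  have ng1 : 0 < n%:R - gamma by rewrite lt_neqAle eq_sym ng0 subr_ge0.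
  have [|e1 e2] := @sI_RL R sigma rho rho_gt0 (n%:R - gamma) t chi (RL gamma Phi) ng1 t0
    (RL_continuous g0 cP).
    by move=> s _; rewrite chiE /twist mulrA -expRD mulNr subrr expR0 mul1r.
  split; first exact: e1.
  by rewrite /J e2 /twist (RL_semigroup _ ng1 g0 cP) subrK.
have SJ := sD_twist rho_gt0 (RL_tower_chain (n := n) cP) (fun t th => (JE t th).2).
split => //.
- split.
  + by move=> k /init[].
  + by move=> t; rewrite /= in_itv/= => /JE[].
  + by move=> t; rewrite /= in_itv/= => th; have [] := SJ n (leqnn n) t th.
- move=> t th; rewrite psif//; have [_] := SJ n (leqnn n) t th.
  by rewrite /RL_tower ltnn.
Qed.


Lemma continuous_closure_zero (z : R -> R) X : continuous z -> 0 < X ->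
  (forall x, 0 < x < X -> z x = 0) -> forall x, 0 <= x <= X -> z x = 0.
Proof.
move=> cz X0 z0 x /andP[x0 xX]; apply/eqP; rewrite -normr_le0 leNgt; apply/negP => zx.
have /cvgrPdist_lt /(_ _ zx) [r /= r0 Hr] := cz x.
pose s := Num.min 1 (r / X).
have s0 : 0 < s by rewrite lt_min ltr01 divr_gt0.
have s1 : s <= 1 by rewrite ge_min lexx.
have sX : s * X <= r by rewrite -ler_pdivlMr// ge_min lexx orbT.
pose y := x + s * (X / 2 - x).
have y_in : 0 < y < X by rewrite /y; apply/andP; split; nra.
have : `|z x - z y| < `|z x|.
  apply: Hr => /=; rewrite /y opprD addNKr normrN normrM gtr0_norm//.
  have : `|X / 2 - x| <= X / 2 by rewrite ler_norml; apply/andP; split; lra.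
  move: (`|_|) => w wX; apply: (@le_lt_trans _ _ (s * (X / 2))).
    by rewrite ler_wpM2l// ltW.
  by nra.
by rewrite (z0 y y_in) subr0 ltxx.
Qed.

(** On continuous functions a fractional integral is injective: completing it to
    an integral of order 1 and differentiating recovers the function. *)
Lemma RL_inj a X (z : R -> R) : 0 < a < 1 -> continuous z -> 0 < X ->
  (forall x, 0 < x < X -> RL a z x = 0) -> forall x, 0 <= x <= X -> z x = 0.
Proof.
move=> /andP[a0 a1] cz X0 RLz; apply: continuous_closure_zero => // x /andP[x0 xX].
have a1' : 0 < 1 - a by rewrite subr_gt0.
have R1 y : y < X -> RL 1 z y = 0.
  move=> yX; rewrite -(subrK a 1) -RL_semigroup//.
  rewrite (@eq_RL _ _ _ (fun=> 0)) ?RL_cst ?mul0r// => w /andP[w0 wy].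
  by rewrite RLz// w0 (lt_trans wy yX).
have [_ <-] := RL1_derive cz x0.
rewrite (@near_eq_derive _ _ _ _ (fun=> 0)) ?derive_cst ?oner_eq0//.
by near=> y; apply: R1; near: y; exact: lt_nbhsl.
Unshelve. all: by end_near. Qed.

Section solution_is_volterra.
Variables (gamma h : R) (b : nat -> R) (H : set (R * R)) (f : R * R -> R).
Variables (psi G : R -> R).
Hypotheses (gamma_gt0 : 0 < gamma) (h_gt0 : 0 < h).
Hypothesis psi_sol : is_solution sigma rho gamma b H f h psi.
Hypothesis G_cont : continuous G.
Hypothesis psi_twist : forall t, 0 <= t <= h -> psi t = twist G t.

Let n := nceil gamma.
Let X := h `^ rho.
Let X_gt0 : 0 < X. Proof. exact: powR_gt0. Qed.
Let u x := G x - taylor b n x.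

Let u_cont : continuous u.
Proof. by move=> x; apply: cvgB; [exact: G_cont|exact: continuous_taylor]. Qed.

Let rhoV_gt0 : 0 < rho^-1. Proof. by rewrite invr_gt0. Qed.

Let root_in d x : 0 <= d -> 0 < x < d `^ rho -> 0 < x `^ rho^-1 < d.
Proof.
move=> d0 /andP[x0 xd]; rewrite powR_gt0//= -[ltRHS](powR_invK rho_gt0 d0).
by apply: gt0_ltr_powR => //; rewrite nnegrE ?powR_ge0// ltW.
Qed.

Let untwist0 (q P : R -> R) x : 0 < x -> q (x `^ rho^-1) = twist P (x `^ rho^-1) ->
  untwist sigma rho h q 0 x = P x.
Proof.
move=> x0 qP; rewrite /untwist /= qP /twist (powR_Kinv rho_gt0 (ltW x0)) mulrA.
by rewrite -expRD mulNr subrr expR0 mul1r.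
Qed.

Let init_cvg k : (k < n)%N -> untwist sigma rho h psi k x @[x --> 0^'+] --> b k.
Proof.
move=> kn; have [_ _ _ _ /(_ k kn)[[_ c] E]] := psi_sol.
have c' : sD sigma rho `]0, h] k psi t @[t --> 0^'+] --> b k by rewrite -E.
have ce : expR (sigma * x) @[x --> (0 : R)^'+] --> (1 : R).
  rewrite -[X in _ --> X]expR0 -[X in expR X](mulr0 sigma).
  apply: (@cvg_comp _ _ _ (fun x => sigma * x) expR _ (nbhs (sigma * 0))).
    by apply: cvgM; [exact: cvg_cst|exact: cvg_at_right_filter].
  exact: continuous_expR.
rewrite -[b k]mul1r; apply: (cvgM ce).
apply: (@cvg_comp _ _ _ (fun x => x `^ rho^-1) (sD sigma rho `]0, h] k psi) _ 0^'+).
  move=> P [r /= r0 Hr]; near=> x; apply: Hr => /=; last first.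
    by apply: powR_gt0; near: x; exact: nbhs_right_gt.
  near: x; have := powR_cvg0 rhoV_gt0; move/cvgrPdist_lt => /(_ r r0).
  exact.
exact: c'.
Unshelve. all: by end_near. Qed.

(** The initial conditions say that [u] vanishes at [0] to order [n - 1] in the
    sense of derivatives; integrating up gives a pointwise bound. *)
Let u_small e : 0 < e ->
  exists2 d, 0 < d & forall x, 0 < x < d -> `|u x| <= e * x ^+ n.-1.
Proof.
move=> e0; have [n0 _] := nceil_itv gamma_gt0; rewrite -/n in n0.
have n'n : (n.-1 < n)%N by rewrite prednK.
have [_ _ _ _ /(_ n.-1 n'n)[[[r /= r0 Hr] _] _]] := psi_sol.
pose d1 := Num.min r h; have d10 : 0 < d1 by rewrite lt_min r0.
have d1h : 0 <= d1 <= h by rewrite ltW//= ge_min lexx orbT.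
have ch := @untwist_chain R sigma rho rho_gt0 h d1 n.-1 psi d1h.
have {}ch : deriv_chain (d1 `^ rho) n.-1 (untwist sigma rho h psi).
  apply: ch => t /andP[t0 td]; apply: Hr => //=.
  by rewrite sub0r normrN gtr0_norm//; apply: lt_le_trans td _; rewrite ge_min lexx.
pose U k x := untwist sigma rho h psi k x - taylor (fun i => b (i + k)%N) (n - k) x.
have U0 k : (k < n)%N -> U k x @[x --> 0^'+] --> 0.
  move=> kn; pose c i := b (i + k)%N.
  have : taylor c (n - k) x @[x --> (0 : R)^'+] --> taylor c (n - k) 0.
    by apply: cvg_at_right_filter; exact: continuous_taylor.
  rewrite taylor0 ?subn_gt0// => ct.
  have := cvgB (init_cvg kn) ct; rewrite /c add0n subrr; exact.
have [d2 /= d20 Hd2] : \forall x \near 0^'+, `|U n.-1 x| < e.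
  by have /cvgr0Pnorm_lt /(_ _ e0) := U0 _ n'n; apply.
pose d := Num.min (d1 `^ rho) d2.
have d0 : 0 < d by rewrite lt_min powR_gt0.
exists d => // x xd.
have xd1 y : 0 < y < d -> 0 < y < d1 `^ rho.
  by move=> /andP[-> yd]; apply: lt_le_trans yd _; rewrite ge_min lexx.
have xd2 y : 0 < y < d -> 0 < y < d2.
  by move=> /andP[-> yd]; apply: lt_le_trans yd _; rewrite ge_min lexx orbT.
have UE : U 0%N x = u x.
  rewrite /U subn0 /u; congr (_ - taylor _ _ _).
    have /andP[x0 _] := xd; apply: untwist0 => //; apply: psi_twist.
    have /andP[t0 td] := root_in (ltW d10) (xd1 x xd).
    rewrite (ltW t0)/= ltW//; apply: lt_le_trans td _; case/andP: d1h => //.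
  by apply/funext => k; rewrite addn0.
rewrite -UE; apply: (@chain_small _ d n.-1 U e _ _ _ x xd).
- move=> k y kn /xd1 yd.
  have kn' : (k < n)%N by apply: leq_trans kn _; exact: leq_pred.
  have := is_derive_add (ch k y kn yd) (is_derive_scale (-1)
    (taylor_derive (fun i => b (i + k)%N) (n - k) y)).
  rewrite /U !mulN1r subnS (_ : (fun i => b (i.+1 + k)%N) = (fun i => b (i + k.+1)%N)).
    by rewrite (_ : (fun y => _ + -1 * _) = U k)//; apply/funext => z; rewrite mulN1r.
  by apply/funext => i; rewrite addSnnS.
- by move=> k kn; apply: U0; apply: leq_trans kn _; exact: leq_pred.
- move=> y /xd2 /andP[y0 yd]; apply/ltW/Hd2 => //=.
  by rewrite sub0r normrN gtr0_norm.
Qed.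

Let W x := if n%:R - gamma == 0 then u x else RL (n%:R - gamma) u x.

Let order_ge0 : 0 <= n%:R - gamma.
Proof. by have [_ /andP[_ ?]] := nceil_itv gamma_gt0; rewrite subr_ge0. Qed.

Let order_gt0 : n%:R - gamma != 0 -> 0 < n%:R - gamma < 1.
Proof.
move=> g0; have [n0 /andP[ng _]] := nceil_itv gamma_gt0; rewrite -/n in n0 ng.
rewrite lt_neqAle eq_sym g0 order_ge0/= ltrBlDr -ltrBlDl.
by rewrite -[n in n%:R - 1](prednK n0) -natr1 addrK.
Qed.

(** Fractional integration preserves smallness of order [x ^+ n.-1]. *)
Let W_small e : 0 < e ->
  exists2 d, 0 < d & forall x, 0 < x < X -> x < d -> `|W x| <= e * x ^+ n.-1.
Proof.
move=> e0; rewrite /W; have [g0|g0] := eqVneq (n%:R - gamma) 0.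
  by have [d d0 Hd] := u_small e0; exists d => // x /andP[x0 _] xd; apply: Hd; rewrite x0.
have /andP[a0 _] := order_gt0 g0; set a := n%:R - gamma in a0 *.
have C0 : 0 <= kern (a + 1) X by rewrite kern_ge0// addr_gt0.
have e1 : 0 < e / (kern (a + 1) X + 1) by rewrite divr_gt0// ltr_wpDl.
have [d d0 Hd] := u_small e1; exists d => // x /andP[x0 xX] xd.
have := @RL_bound R a u x (e / (kern (a + 1) X + 1) * x ^+ n.-1) a0 u_cont.
move=> /(_ _)/le_trans; apply.
  move=> y /andP[y0 yx]; apply: le_trans (Hd y _) _; first by rewrite y0 (lt_trans yx).
  by rewrite ler_wpM2l ?(ltW e1)// lerXn2r ?nnegrE ?ltW.
have kx : kern (a + 1) x <= kern (a + 1) X.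
  by apply: kern_homo; [rewrite lerDr ltW|exact: ltW].
rewrite mulrAC ler_wpM2r ?exprn_ge0 ?(ltW x0)//.
rewrite mulrAC ler_pdivrMr ?ltr_wpDl// ler_wpM2l ?(ltW e0)//.
by apply: le_trans kx _; rewrite lerDl.
Qed.

Let RL_small Phi e : continuous Phi -> 0 < e ->
  exists2 d, 0 < d & forall x, 0 < x < X -> x < d -> `|RL n%:R Phi x| <= e * x ^+ n.-1.
Proof.
move=> cP e0; have [n0 _] := nceil_itv gamma_gt0; rewrite -/n in n0.
have [M M0 PM] := @continuous_bounded R Phi X cP.
have n0' : 0 < n%:R :> R by rewrite ltr0n.
have G0 : 0 < Gamma (n%:R + 1 : R) by rewrite Gamma_gt0// addr_gt0.
pose C := M / Gamma (n%:R + 1 : R) + 1.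
have C0 : 0 < C by rewrite ltr_wpDl// divr_ge0// ltW.
exists (e / C); first by rewrite divr_gt0.
move=> x /andP[x0 xX] xd.
have := @RL_bound R n%:R Phi x M n0' cP; move=> /(_ _)/le_trans; apply.
  by move=> y /andP[y0 yx]; apply: PM; rewrite (ltW y0) (ltW (lt_trans yx xX)).
rewrite kern_gt0E// addrK powR_mulrn ?(ltW x0)// -{1}(prednK n0) exprS.
rewrite (_ : M * _ = (M / Gamma (n%:R + 1)) * x * x ^+ n.-1); last by ring.
rewrite ler_wpM2r ?exprn_ge0 ?(ltW x0)//.
by move: xd; rewrite ltr_pdivlMr// /C; move: (M / _) => m; lra.
Qed.

Let chi s := psi s - sTaylor sigma rho `]0, h] n psi s.

Let chi_twist s : 0 <= s <= h -> chi s = twist u s.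
Proof.
move=> sh; rewrite /chi (@sTaylor_twist _ _ b).
  by rewrite psi_twist// /twist -mulrBr.
by move=> k kn; have [_ _ _ _ /(_ k kn)[]] := psi_sol.
Qed.

Let sI_twist t : 0 < t <= h -> sI sigma rho (n%:R - gamma) chi t = twist W t.
Proof.
move=> /andP[t0 th]; rewrite /W; have [g0|g0] := eqVneq (n%:R - gamma) 0.
  by rewrite /sI g0 eqxx chi_twist// (ltW t0).
have /andP[a0 _] := order_gt0 g0.
have [|_ ->//] := @sI_RL R sigma rho rho_gt0 (n%:R - gamma) t chi u a0 t0 u_cont.
move=> s /andP[s0 st]; rewrite chi_twist ?(ltW s0) ?(ltW (lt_le_trans st th))//.
by rewrite /twist mulrA -expRD mulNr subrr expR0 mul1r.
Qed.

(** The differential equation says that the [n]-th derivative of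
    [W = RL (n - gamma) u] is [Phi], so [W - RL n Phi] is a polynomial of degree
    below [n].  Both terms are negligible before [x ^+ n.-1] at [0], hence this
    polynomial vanishes.  By the semigroup law [RL (n - gamma)] annihilates
    [u - RL gamma Phi], and fractional integration is injective. *)
Theorem solution_is_volterra Phi : continuous Phi ->
  (forall t, 0 < t <= h -> f (t, psi t) = twist Phi t) ->
  forall x, 0 <= x <= X -> G x = taylor b n x + RL gamma Phi x.
Proof.
move=> cP fPhi; have [n0 /andP[_ gn]] := nceil_itv gamma_gt0; rewrite -/n in n0 gn.
have n0' : 0 < n%:R :> R by rewrite ltr0n.
have [_ _ [_ _ sDJ] sDf _] := psi_sol.
have Wc : continuous W.
  rewrite /W; have [g0|g0] := eqVneq (n%:R - gamma) 0; first exact: u_cont.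
  by have /andP[a0 _] := order_gt0 g0; exact: RL_continuous.
pose J := sI sigma rho (n%:R - gamma) chi.
have h0h : 0 <= h <= h by rewrite lexx ltW.
have chJ : deriv_chain X n (untwist sigma rho h J).
  apply: (@untwist_chain R sigma rho rho_gt0 h h n J h0h) => t /andP[t0 th].
  by apply: sDJ; rewrite /= in_itv/= t0 ltW.
have JW x : 0 < x < X -> untwist sigma rho h J 0 x = W x.
  move=> xX; have /andP[x0 _] := xX; apply: untwist0 => //; apply: sI_twist.
  by have /andP[-> /ltW ->] := root_in (ltW h_gt0) xX.
have JPhi x : 0 < x < X -> untwist sigma rho h J n x = Phi x.
  move=> xX; have /andP[x0 _] := xX.
  have /andP[t0 th] := root_in (ltW h_gt0) xX.
  have th' : 0 < x `^ rho^-1 <= h by rewrite t0 ltW.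
  have := sDf _ th'; rewrite (fPhi _ th') => E.
  rewrite /untwist; rewrite /sCaputo /sRL -/n -/chi -/J in E.
  rewrite E /twist (powR_Kinv rho_gt0 (ltW x0)) mulrA.
  by rewrite -expRD mulNr subrr expR0 mul1r.
pose V j x := untwist sigma rho h J j x - RL_tower n Phi j x.
have V0 x : 0 < x < X -> V 0%N x = 0.
  have nE : n.-1.+1 = n by exact: prednK.
  apply: (@chain_zero _ X n.-1 V).
  - rewrite nE => k y kn yX; have /andP[y0 _] := yX.
    have := is_derive_add (chJ k y kn yX)
      (is_derive_scale (-1) (RL_tower_chain cP kn y0)).
    rewrite /V mulN1r (_ : (fun y => _ + -1 * _) = V k)//.
    by apply/funext => z; rewrite mulN1r.
  - by move=> y yX; rewrite nE /V JPhi// /RL_tower ltnn subrr.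
  - move=> e e0; have e2 : 0 < e / 2 by rewrite divr_gt0.
    have [d1 d10 H1] := W_small e2; have [d2 d20 H2] := RL_small cP e2.
    exists (Num.min d1 d2); first by rewrite lt_min d10.
    move=> y yX; rewrite lt_min => /andP[y1 y2].
    rewrite /V JW// /RL_tower n0 subn0; apply: le_trans (ler_normB _ _) _.
    have := H1 y yX y1; have := H2 y yX y2.
    by move: (`|W y|) (`|RL _ _ _|) (y ^+ _) => p q r; lra.
have WRL x : 0 < x < X -> W x = RL n%:R Phi x.
  move=> xX; have := V0 x xX; rewrite /V JW// /RL_tower n0 subn0.
  by move=> /eqP; rewrite subr_eq0 => /eqP.
suff z0 x : 0 <= x <= X -> u x - RL gamma Phi x = 0.
  move=> x xX; have /eqP := z0 x xX.
  by rewrite subr_eq0 /u subr_eq addrC => /eqP.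
have cRL := RL_continuous gamma_gt0 cP.
have cz : continuous (fun x => u x - RL gamma Phi x).
  by move=> y; apply: cvgB; [exact: u_cont|exact: cRL].
have [g0|g0] := eqVneq (n%:R - gamma) 0.
  apply: (continuous_closure_zero cz X_gt0) => y yX.
  have nE : n%:R = gamma by apply/eqP; rewrite -subr_eq0 g0.
  by have := WRL y yX; rewrite /W g0 eqxx nE => ->; rewrite subrr.
apply: (RL_inj (order_gt0 g0) cz X_gt0) => y yX.
have /andP[a0 _] := order_gt0 g0.
rewrite (RLB _ a0 u_cont cRL) (RL_semigroup _ a0 gamma_gt0 cP) subrK.
by have := WRL y yX; rewrite /W (negPf g0) => ->; rewrite subrr.
Qed.

End solution_is_volterra.
End caputo_volterra.

(** * The right-hand side projected onto its domain *)

Section clipped_equation.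
Context {R : realType}.
Variables (sigma rho K hstar L M : R) (b : nat -> R) (m : nat) (f : R * R -> R).
Hypotheses (sigma_gt0 : 0 < sigma) (rho_gt0 : 0 < rho) (K_gt0 : 0 < K)
  (hstar_gt0 : 0 < hstar) (L_ge0 : 0 <= L) (M_ge0 : 0 <= M).
Let H := domH sigma rho m b K hstar.
Hypotheses (f_cont : {within H, continuous f})
  (f_bounded : forall p, H p -> `|f p| <= M)
  (f_lipschitz : forall t y y', H (t, y) -> H (t, y') ->
     `|f (t, y) - f (t, y')| <= L * `|y - y'|).
Local Opaque Gamma RL kern.
Local Notation twist := (twist sigma rho).

Let T := taylor b m.

Let rhoV_gt0 : 0 < rho^-1. Proof. by rewrite invr_gt0. Qed.

Lemma domH_twist t y : H (t, y) <-> 0 <= t <= hstar /\ `|y - twist T t| <= K.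
Proof.
rewrite /H /domH /=.
suff -> : expR (- sigma * t `^ rho) *
    (\sum_(k < m) b k / Gamma (k%:R + 1) * t `^ (rho * k%:R)) = twist T t by [].
rewrite /twist /T /taylor; congr (_ * _); apply: eq_bigr => k _.
by rewrite Gamma_fact powRrM powR_mulrn ?powR_ge0.
Qed.

Let X1 := Num.min 1 (hstar `^ rho).
Let X1_gt0 : 0 < X1. Proof. by rewrite lt_min ltr01 powR_gt0. Qed.
Let clipx (x : R) := Num.min (Num.max 0 x) X1.
Let clipK (v : R) := Num.max (- K) (Num.min K v).
Let time (x : R) := clipx x `^ rho^-1.
Let state (x y : R) := expR (- sigma * clipx x) * T (clipx x) +
  clipK (expR (- sigma * clipx x) * (y - T (clipx x))).

(** The right-hand side of the equation for the normalized solution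
    [y = expR (sigma * x) * psi] at [x = t `^ rho].  The time and the distance
    from the Taylor part are projected onto the domain of [f], so that the
    function is defined, bounded and Lipschitz in [y] on the whole plane.  The
    variable [x] is moreover kept in [0, 1], where its powers and the factor
    [expR (sigma * x)] are bounded. *)
Definition clipped_rhs x y : R := expR (sigma * clipx x) * f (time x, state x y).

Let clipx_itv x : 0 <= clipx x <= X1.
Proof. by rewrite le_min ge_min lexx orbT le_max lexx (ltW X1_gt0). Qed.

Let clipx_id x : 0 <= x <= X1 -> clipx x = x.
Proof. by move=> /andP[x0 xX]; rewrite /clipx max_r// min_l. Qed.

Let clipK_le v : `|clipK v| <= K.
Proof.
rewrite /clipK ler_norml le_max lexx/= ge_max ge_min lexx/= andbT.
by have := K_gt0; lra.
Qed.

Let clipK_id v : `|v| <= K -> clipK v = v.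
Proof. by rewrite ler_norml /clipK => /andP[v1 v2]; rewrite min_r// max_r. Qed.

Let clipK_lip v w : `|clipK v - clipK w| <= `|v - w|.
Proof.
have K0 := K_gt0.
have cE u : [\/ K <= u /\ clipK u = K, u <= - K /\ clipK u = - K |
                - K <= u <= K /\ clipK u = u].
  have [Ku|uK] := leP K u.
    by apply: Or31; split=> //; rewrite /clipK min_l// max_r//; lra.
  have [uK'|Ku'] := leP u (- K).
    by apply: Or32; split=> //; rewrite /clipK min_r ?(ltW uK)// max_l.
  by apply: Or33; rewrite (ltW Ku') (ltW uK) clipK_id// ler_norml !ltW.
have : v - w <= `|v - w| by exact: ler_norm.
have : w - v <= `|v - w| by rewrite distrC ler_norm.
move: (`|v - w|) => d h1 h2; rewrite ler_norml.
by case: (cE v) => [[? ->]|[? ->]|[/andP[? ?] ->]];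
   case: (cE w) => [[? ->]|[? ->]|[/andP[? ?] ->]]; apply/andP; split; lra.
Qed.

Let time_powR x : time x `^ rho = clipx x.
Proof. by rewrite powR_Kinv//; case/andP: (clipx_itv x). Qed.

Let time_itv x : 0 <= time x <= hstar.
Proof.
rewrite powR_ge0/= -[leRHS](powR_invK rho_gt0 (ltW hstar_gt0)).
have /andP[x0 xX] := clipx_itv x.
apply: ge0_ler_powR; rewrite ?nnegrE ?powR_ge0 ?(ltW rhoV_gt0)//.
by apply: le_trans xX _; rewrite ge_min lexx orbT.
Qed.

Let state_in x y : H (time x, state x y).
Proof.
apply/domH_twist; split; first exact: time_itv.
by rewrite /twist time_powR /state addrC addKr.
Qed.

Let clipx_cont : continuous clipx.
Proof.
move=> x; apply: continuous_min; last exact: cvg_cst.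
exact: continuous_max0.
Qed.

Let clipK_cont : continuous clipK.
Proof.
move=> x; apply/cvgrPdist_lt => e e0; near=> y.
apply: le_lt_trans (clipK_lip x y) _; near: y.
by have /cvgrPdist_lt := @cvg_id R (nbhs x); apply.
Unshelve. all: by end_near. Qed.

Lemma within_comp_continuous (S : topologicalType) (A : set S) (q : S -> R) (p : R -> S) :
  {within A, continuous q} -> continuous p -> (forall x, A (p x)) ->
  continuous (fun x => q (p x)).
Proof.
move=> /subspace_continuousP qc pc pA x.
apply: (@cvg_comp _ _ _ p q _ (within A (nbhs (p x)))); last exact: qc.
move=> P /= PA; have N := pc x _ PA.
change (nbhs x (fun z => A (p z) -> P (p z))) in N.
suff : nbhs x (fun z => P (p z)) by [].
by apply: (filterS _ N) => z /(_ (pA z)).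
Qed.

Let expR_lin_cont c (g : R -> R) : continuous g -> continuous (fun x => expR (c * g x)).
Proof.
move=> cg x; apply: (@continuous_comp R R R (fun x => c * g x) expR).
  by apply: cvgM; [exact: cvg_cst|exact: cg].
exact: continuous_expR.
Qed.

Lemma clipped_rhs_superposes : superposes clipped_rhs.
Proof.
move=> g cg; have Tc : continuous (fun x => T (clipx x)).
  by move=> x; apply: (@continuous_comp R R R clipx T); [exact: clipx_cont|exact: continuous_taylor].
have ec := @expR_lin_cont (- sigma) clipx clipx_cont.
have sc : continuous (fun x => state x (g x)).
  move=> x; apply: cvgD; first by apply: cvgM; [exact: ec|exact: Tc].
  apply: (@continuous_comp R R R (fun x => expR (- sigma * clipx x) * (g x - T (clipx x))) clipK).
    apply: cvgM; first exact: ec.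
    by apply: cvgB; [exact: cg|exact: Tc].
  exact: clipK_cont.
have tc : continuous time.
  have -> : time = (fun x => (Num.max 0 (clipx x)) `^ rho^-1).
    by apply/funext => y; rewrite max_r//; case/andP: (clipx_itv y).
  move=> x; apply: (@continuous_comp R R R clipx (fun x => (Num.max 0 x) `^ rho^-1)).
    exact: clipx_cont.
  by apply: continuous_powR_max0.
move=> x; apply: cvgM; first exact: (@expR_lin_cont sigma clipx clipx_cont).
apply: (@within_comp_continuous _ H f (fun x => (time x, state x (g x))) f_cont).
  by move=> y; exact: (cvg_pair (tc y) (sc y)).
by move=> y; exact: state_in.
Qed.

(** The two exponential factors cancel, so the constant of [f] is preserved. *)
Lemma clipped_rhs_lipschitz : rlipschitz L clipped_rhs.
Proof.
move=> x y y'; rewrite /clipped_rhs -mulrBr normrM ger0_norm ?expR_ge0//.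
apply: (@le_trans _ _ (expR (sigma * clipx x) *
    (L * (expR (- sigma * clipx x) * `|y - y'|)))).
  rewrite ler_wpM2l ?expR_ge0//; apply: le_trans (f_lipschitz (state_in x y) (state_in x y')) _.
  rewrite ler_wpM2l// /state opprD addrACA subrr add0r; apply: le_trans (clipK_lip _ _) _.
  by rewrite -mulrBr opprB addrA subrK normrM ger0_norm ?expR_ge0.
by rewrite mulrCA (mulrA (expR (sigma * _))) -expRD mulNr subrr expR0 mul1r.
Qed.

Lemma clipped_rhs_bound x y : `|clipped_rhs x y| <= expR sigma * M.
Proof.
rewrite /clipped_rhs normrM ger0_norm ?expR_ge0//; apply: ler_pM; rewrite ?expR_ge0//.
  rewrite ler_expR ler_piMr ?(ltW sigma_gt0)//.
  by have /andP[_ /le_trans->//] := clipx_itv x; rewrite ge_min lexx.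
by apply: f_bounded; exact: state_in.
Qed.


Variable X : R.
Hypotheses (X_gt0 : 0 < X) (X_le : X <= X1).
Let h := X `^ rho^-1.
Let h_gt0 : 0 < h. Proof. exact: powR_gt0. Qed.
Let hX : h `^ rho = X. Proof. by rewrite powR_Kinv// ltW. Qed.
Local Notation F := clipped_rhs.
Local Notation M' := (expR sigma * M).

Let F_sup := clipped_rhs_superposes.
Let F_lip := clipped_rhs_lipschitz.

Let time_range t : 0 <= t <= h -> 0 <= t `^ rho <= X.
Proof.
move=> /andP[t0 th]; rewrite powR_ge0/= -hX.
by apply: ge0_ler_powR; rewrite ?nnegrE ?powR_ge0 ?(ltW rho_gt0).
Qed.

Let h_le : h <= hstar.
Proof.
rewrite -[leRHS](powR_invK rho_gt0 (ltW hstar_gt0)).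
apply: ge0_ler_powR; rewrite ?nnegrE ?powR_ge0 ?(ltW rhoV_gt0) ?(ltW X_gt0)//.
by apply: le_trans X_le _; rewrite ge_min lexx orbT.
Qed.

(** On graphs contained in the domain the projection does nothing. *)
Let clipped_rhs_exact (G : R -> R) t : 0 <= t <= h -> H (t, twist G t) ->
  twist (fun x => F x (G x)) t = f (t, twist G t).
Proof.
move=> th /domH_twist[_ HK].
have /andP[t0 _] := th; have /andP[x0 xX] := time_range th.
have cx : clipx (t `^ rho) = t `^ rho by rewrite clipx_id// x0 (le_trans xX).
have tE : time (t `^ rho) = t by rewrite /time cx powR_invK.
rewrite {1}/twist /clipped_rhs tE cx mulrA -expRD mulNr addNr expR0 mul1r.
congr (f (t, _)); rewrite /state cx clipK_id; first by rewrite -mulrDr addrC subrK.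
by move: HK; rewrite /twist -mulrBr.
Qed.


(** The solution of the projected equation stays in the domain: its Taylor part
    and its integral part each use up at most half of the admissible distance
    [K]. *)
Lemma clipped_solution_exists gamma (b' : nat -> R) : 0 < gamma ->
  L * kern (gamma + 1) X <= 2^-1 -> M' * kern (gamma + 1) X <= K / 2 ->
  (forall x, 0 <= x <= X -> `|taylor b' (nceil gamma) x - T x| <= K / 2) ->
  exists psi, is_solution sigma rho gamma b' H f h psi.
Proof.
move=> g0 LX MX TX; set T' := taylor b' (nceil gamma).
have cT' : continuous T' by exact: continuous_taylor.
have [w cw wE] := volterra_exists F_sup F_lip L_ge0 g0 X_gt0 LX cT'.
pose Phi x := F x (w x); have cPhi : continuous Phi := F_sup cw.
pose G x := T' x + RL gamma Phi x.
have GE x : 0 <= x <= X -> G x = w x by move=> xX; rewrite /G wE.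
have inH t : 0 <= t <= h -> H (t, twist G t).
  move=> th; have xX := time_range th; have /andP[t0 t1] := th.
  apply/domH_twist; split; first by rewrite t0 (le_trans t1).
  rewrite /twist -mulrBr normrM ger0_norm ?expR_ge0//.
  apply: (@le_trans _ _ (1 * `|G (t `^ rho) - T (t `^ rho)|)).
    rewrite ler_wpM2r// -expR0 ler_expR mulNr oppr_le0 mulr_ge0 ?powR_ge0//.
    exact: ltW.
  rewrite mul1r /G addrAC; apply: le_trans (ler_normD _ _) _.
  have h1 := TX _ xX.
  have h2 : `|RL gamma Phi (t `^ rho)| <= M' * kern (gamma + 1) X.
    have h3 := @RL_bound R gamma Phi (t `^ rho) M' g0 cPhi.
    apply: le_trans (h3 _) _; first by move=> y _; exact: clipped_rhs_bound.
    rewrite ler_wpM2l ?mulr_ge0 ?expR_ge0//; case/andP: xX => x0 xX.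
    by apply: kern_homo => //; rewrite lerDr ltW.
  by rewrite -/T' in h1; lra.
exists (twist G); apply: volterra_is_solution => //.
- move=> t /andP[t0 th]; have th' : 0 <= t <= h by rewrite (ltW t0).
  have -> : twist Phi t = twist (fun x => F x (G x)) t.
    by rewrite /twist /Phi GE// time_range.
  by rewrite clipped_rhs_exact//; exact: inH.
- pose q t := expR (- sigma * (Num.max 0 t) `^ rho) * G ((Num.max 0 t) `^ rho).
  have cq : continuous q.
    move=> t; apply: cvgM.
      exact: (@expR_lin_cont (- sigma) _ (continuous_powR_max0 rho_gt0)).
    apply: (@continuous_comp R R R (fun t => (Num.max 0 t) `^ rho) G).
      exact: continuous_powR_max0.
    by apply: cvgD; [exact: cT'|exact: RL_continuous].
  have qE t : 0 <= t -> q t = twist G t by move=> t0; rewrite /q max_r.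
  have : {within `[0, h], continuous q} by exact: continuous_subspaceT.
  apply: subspace_eq_continuous => t; rewrite inE/= in_itv/= => /andP[t0 _].
  exact: qE.
Qed.

(** Every solution solves the projected equation, because its graph lies in the
    domain; [G] is the normalized solution continued by constants outside
    [0, X]. *)
Lemma clipped_solution_volterra gamma (b' : nat -> R) psi : 0 < gamma ->
  is_solution sigma rho gamma b' H f h psi ->
  exists G, [/\ continuous G, forall t, 0 <= t <= h -> psi t = twist G t &
    forall x, 0 <= x <= X ->
      G x = taylor b' (nceil gamma) x + RL gamma (fun y => F y (G y)) x].
Proof.
move=> g0 psi_sol; have [psic psiH _ _ _] := psi_sol.
pose clip x := Num.min (Num.max 0 x) X : R.
have clip_in x : 0 <= clip x <= X.
  by rewrite /clip le_min ge_min lexx orbT le_max lexx (ltW X_gt0).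
have clipE x : 0 <= x <= X -> clip x = x.
  by move=> /andP[x0 xX]; rewrite /clip max_r// min_l.
have cclip : continuous clip.
  by move=> x; apply: continuous_min; [exact: continuous_max0|exact: cvg_cst].
pose root x := clip x `^ rho^-1.
have croot : continuous root.
  have -> : root = (fun x => (Num.max 0 (clip x)) `^ rho^-1).
    by apply/funext => y; rewrite max_r//; case/andP: (clip_in y).
  move=> x; apply: (@continuous_comp R R R clip (fun x => (Num.max 0 x) `^ rho^-1)).
    exact: cclip.
  by apply: continuous_powR_max0.
pose G x := expR (sigma * clip x) * psi (root x).
have cG : continuous G.
  move=> x; apply: cvgM; first exact: (@expR_lin_cont sigma clip cclip).
  apply: (@within_comp_continuous R `[0, h] psi root psic croot) => y.
  rewrite /= in_itv/= powR_ge0/=; have /andP[y0 yX] := clip_in y.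
  by apply: ge0_ler_powR; rewrite ?nnegrE ?(ltW rhoV_gt0) ?(ltW X_gt0).
have psiG t : 0 <= t <= h -> psi t = twist G t.
  move=> th; have /andP[t0 _] := th.
  rewrite /twist /G /root clipE ?time_range// powR_invK//.
  by rewrite mulrA -expRD mulNr addNr expR0 mul1r.
exists G; split=> //; rewrite -hX.
apply: (solution_is_volterra rho_gt0 g0 h_gt0 psi_sol cG psiG); first exact: F_sup.
move=> t /andP[t0 th]; have th' : 0 <= t <= h by rewrite (ltW t0).
by rewrite clipped_rhs_exact -?psiG//; exact: psiH.
Qed.

Lemma clipped_solution_defined gamma (b' : nat -> R) : 0 < gamma ->
  L * kern (gamma + 1) X <= 2^-1 -> M' * kern (gamma + 1) X <= K / 2 ->
  (forall x, 0 <= x <= X -> `|taylor b' (nceil gamma) x - T x| <= K / 2) ->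
  solution_defined sigma rho gamma b' H f h.
Proof.
move=> g0 LX MX TX.
have [psi psi_sol] := clipped_solution_exists g0 LX MX TX.
exists psi => // psi' psi'_sol t th.
have [G [cG psiG GE]] := clipped_solution_volterra g0 psi_sol.
have [G' [cG' psiG' GE']] := clipped_solution_volterra g0 psi'_sol.
rewrite psiG// psiG'// /twist; congr (_ * _); apply/eqP.
rewrite -subr_eq0 -normr_le0 -[leRHS](mulr0 2).
apply: (volterra_stability F_sup F_lip L_ge0 g0 (ltW X_gt0) LX cG' cG); last exact: time_range.
by move=> x xX; rewrite {1}GE'// {1}GE// !addrK subrr normr0.
Qed.

(** The solution of order [alpha'] satisfies the equation of order [alpha] up to
    an error consisting of the difference of the Taylor parts and of the change
    of the integral with its order; stability of the Volterra equation then
    gives the estimate. *)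
Lemma clipped_solution_dist alpha alpha' (b' : nat -> R) S D psi phi :
  0 < alpha -> nceil alpha = m -> alpha <= alpha' <= alpha + 1 ->
  (alpha' - alpha) * Gamma_slope alpha <= Gamma alpha / 2 ->
  (forall x, 0 <= x <= X -> order_slope_int alpha x <= S) ->
  (forall x, 0 <= x <= X -> `|taylor b' (nceil alpha') x - T x| <= D) ->
  L * kern (alpha + 1) X <= 2^-1 ->
  is_solution sigma rho alpha b H f h psi ->
  is_solution sigma rho alpha' b' H f h phi ->
  forall t, 0 <= t <= h ->
    `|psi t - phi t| <= 2 * (D + M' * (alpha' - alpha) * S).
Proof.
move=> a0 am /andP[aa' a'1] slope HS HD LX psi_sol phi_sol t th.
have a'0 : 0 < alpha' := lt_le_trans a0 aa'.
have [G [cG psiG GE]] := clipped_solution_volterra a0 psi_sol.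
have [G' [cG' phiG' GE']] := clipped_solution_volterra a'0 phi_sol.
have M'0 : 0 <= M' by rewrite mulr_ge0// expR_ge0.
have d01 : 0 <= alpha' - alpha <= 1 by apply/andP; split; lra.
rewrite psiG// phiG'// /twist -mulrBr normrM ger0_norm ?expR_ge0//.
apply: (@le_trans _ _ (1 * `|G (t `^ rho) - G' (t `^ rho)|)).
  rewrite ler_wpM2r// -expR0 ler_expR mulNr oppr_le0 mulr_ge0 ?powR_ge0//.
  exact: ltW.
rewrite mul1r.
apply: (volterra_stability F_sup F_lip L_ge0 a0 (ltW X_gt0) LX cG cG'); last exact: time_range.
move=> x xX; rewrite {1}GE// {1}GE'// addrK am -/T.
have h1 := HD x xX.
have h2 := @RL_order_diff R alpha (alpha' - alpha) (fun y => F y (G' y)) x M'.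
have {}h2 := h2 a0 d01 slope (F_sup cG') M'0 (fun y _ => clipped_rhs_bound y _).
have aE : alpha + (alpha' - alpha) = alpha' by ring.
rewrite aE in h2.
have h3 : M' * (alpha' - alpha) * order_slope_int alpha x <= M' * (alpha' - alpha) * S.
  by rewrite ler_wpM2l ?HS// mulr_ge0//; case/andP: d01.
move: h1 h2 h3; move: (taylor _ _ x) (T x) (RL alpha' _ x) (RL alpha _ x).
move=> p q r s h1 h2 h3; move: h1 h2; rewrite !ler_norml => /andP[? ?] /andP[? ?].
by apply/andP; split; lra.
Qed.

End clipped_equation.

(** * Estimates for the choice of the constants *)

Section constants.
Context {R : realType}.
Local Opaque Gamma RL kern.

Lemma order_slope_int_homo (a : R) : 0 < a ->
  {homo order_slope_int a : x y / x <= y}.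
Proof.
move=> a0 x y xy; have G c : 0 < c -> 0 <= Gamma c :> R by move=> c0; rewrite ltW// Gamma_gt0.
have a20 : 0 < a / 2 by rewrite divr_gt0.
have kc c : 0 < c -> kern (c + 1) x <= kern (c + 1) y.
  by move=> c0; apply: kern_homo => //; rewrite lerDr ltW.
apply: ler_wpM2l; first by rewrite divr_ge0// G.
apply: lerD; first apply: lerD; apply: ler_wpM2l.
- by rewrite mulr_ge0 ?divr_ge0 ?G ?(ltW a0).
- exact: kc.
- by rewrite G// addr_gt0.
- by apply: kc; rewrite addr_gt0.
- exact: Gamma_slope_ge0.
- exact: kc.
Qed.

Lemma order_slope_int_ge0 (a x : R) : 0 < a -> 0 <= x -> 0 <= order_slope_int a x.
Proof.
move=> a0 x0; apply: le_trans (order_slope_int_homo a0 x0).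
by rewrite /order_slope_int !kern_le0// !mulr0 !addr0 mulr0.
Qed.

(** The dependence of the integral on its order, for the constant function 1. *)
Lemma kern_order_le (a d x : R) : 0 < a -> 0 <= d <= 1 ->
  d * Gamma_slope a <= Gamma a / 2 ->
  kern (a + d + 1) x <= kern (a + 1) x + d * order_slope_int a x.
Proof.
move=> a0 d01 slope; have ad0 : 0 < a + d by rewrite ltr_wpDr//; case/andP: d01.
have c1 : continuous (fun _ : R => 1 : R) by move=> y; exact: cvg_cst.
have := @RL_order_diff R a d (fun=> 1) x 1 a0 d01 slope c1 ler01.
rewrite !RL_cst// !mul1r => /(_ _)/ler_normlW => H.
by rewrite -lerBlDl H// => y _; rewrite normr1.
Qed.

Lemma kern_small (c e : R) : 1 < c -> 0 < e ->
  exists2 d, 0 < d & forall x, x < d -> kern c x <= e.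
Proof.
move=> c1 e0; have /cvgrPdist_lt/(_ e e0)[d /= d0 Hd] := @continuous_kern R c c1 0.
exists d => // x xd; have [x0|x0] := leP x 0; first by rewrite kern_le0// ltW.
have := Hd x; rewrite /= sub0r normrN gtr0_norm// => /(_ xd).
by rewrite kern_le0// sub0r normrN => /ltW; apply: le_trans; exact: ler_norm.
Qed.

Lemma mul_frac_le (a c : R) : 0 <= a -> 0 <= c -> a * (c / (a + 1)) <= c.
Proof.
by move=> a0 c0; rewrite mulrCA ler_piMr// ler_pdivrMr ?ltr_wpDl// mul1r lerDl.
Qed.

(** At most one term is added, and on [0, 1] it is bounded by its coefficient. *)
Lemma taylor_dist (b b' : nat -> R) m m' x : (m' == m) || (m' == m.+1) ->
  (forall k, (k < m)%N -> b' k = b k) -> 0 <= x <= 1 ->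
  `|taylor b' m' x - taylor b m x| <= max_abs_coef b' m m'.
Proof.
move=> mm' bb' /andP[x0 x1].
have E : taylor b' m x = taylor b m x.
  by rewrite /taylor; apply: eq_bigr => k _; rewrite bb'.
case/orP: mm' => /eqP ->; first by rewrite E subrr normr0 /max_abs_coef big_geq.
rewrite /max_abs_coef big_ltn// big_geq// max_l// -E /taylor big_ord_recr/=.
rewrite addrAC subrr add0r normrM normrM normfV -mulrA ler_piMr//.
rewrite [`|x ^+ m|]ger0_norm ?exprn_ge0// ger0_norm ?ler0n// mulrC.
rewrite ler_pdivrMr ?ltr0n ?fact_gt0// mul1r.
by apply: le_trans (exprn_ile1 _ x0 x1) _; rewrite ler1n fact_gt0.
Qed.

End constants.

Local Opaque Gamma RL kern.

Theorem theorem14 (R : realType) (sigma rho alpha K hstar : R) (b : nat -> R)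
    (f : R * R -> R)
    (sigma_gt0 : 0 < sigma) (rho_gt0 : 0 < rho) (alpha_gt0 : 0 < alpha)
    (K_gt0 : 0 < K) (hstar_gt0 : 0 < hstar)
    (f_cont : {within domH sigma rho (nceil alpha) b K hstar, continuous f})
    (f_bounded : exists M : R, forall p,
       domH sigma rho (nceil alpha) b K hstar p -> `|f p| <= M)
    (f_lipschitz : exists2 L : R, 0 < L & forall t y y' : R,
       domH sigma rho (nceil alpha) b K hstar (t, y) ->
       domH sigma rho (nceil alpha) b K hstar (t, y') ->
       `|f (t, y) - f (t, y')| <= L * `|y - y'|) :
  let m := nceil alpha in
  let H := domH sigma rho m b K hstar in
  exists eps0 h C : R,
    [/\ 0 < eps0, 0 < h, 0 < C &
      forall (alpha' : R) (b' : nat -> R),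
        alpha < alpha' ->
        (forall k, (k < m)%N -> b' k = b k) ->
        let eps := alpha' - alpha in
        let eps' := max_abs_coef b' m (nceil alpha') in
        eps <= eps0 -> eps' <= eps0 ->
        [/\ solution_defined sigma rho alpha b H f h,
            solution_defined sigma rho alpha' b' H f h &
            forall psi phi : R -> R,
              is_solution sigma rho alpha b H f h psi ->
              is_solution sigma rho alpha' b' H f h phi ->
              (ereal_sup [set `|psi t - phi t|%:E | t in `[0%R, h]%classic]
                 <= (C * (eps + eps'))%:E)%E]].
Proof.
move=> m H; have [M0 f_M0] := f_bounded; have [L L_gt0 f_L] := f_lipschitz.
pose M := `|M0|; have M_ge0 : 0 <= M by exact: normr_ge0.
have f_M p : H p -> `|f p| <= M.
  by move=> Hp; apply: le_trans (f_M0 p Hp) _; exact: ler_norm.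
have L_ge0 := ltW L_gt0; set M' := expR sigma * M.
have M'_ge0 : 0 <= M' by rewrite mulr_ge0// expR_ge0.
(* [kappa] bounds the kernel of order [alpha + 1] on [0, X] with a factor 2 to
   spare, which is used up by the kernels of order [alpha' + 1]. *)
pose kappa := Num.min (4^-1 / (L + 1)) (K / 4 / (M' + 1)).
have L1_gt0 : 0 < L + 1 by rewrite addr_gt0.
have M'1_gt0 : 0 < M' + 1 by rewrite ltr_wpDl.
have kappa_gt0 : 0 < kappa by rewrite lt_min !divr_gt0// invr_gt0.
have L_kappa : L * kappa <= 4^-1.
  apply: le_trans (mul_frac_le L_ge0 _); last by rewrite invr_ge0.
  by rewrite ler_wpM2l// ge_min lexx.
have M_kappa : M' * kappa <= K / 4.
  apply: le_trans (mul_frac_le M'_ge0 _); last by rewrite divr_ge0// ltW.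
  by rewrite ler_wpM2l// ge_min lexx orbT.
have [|d d_gt0 kern_d] := @kern_small R (alpha + 1) kappa _ kappa_gt0.
  by rewrite ltrDr.
pose X := Num.min (Num.min 1 (hstar `^ rho)) (d / 2).
have X_gt0 : 0 < X by rewrite !lt_min ltr01 powR_gt0// divr_gt0.
have X_le : X <= Num.min 1 (hstar `^ rho) by rewrite ge_min lexx.
have X_le1 : X <= 1 by apply: le_trans X_le _; rewrite ge_min lexx.
have kern_X : kern (alpha + 1) X <= kappa.
  apply: kern_d; apply: (@le_lt_trans _ _ (d / 2)); first by rewrite ge_min lexx orbT.
  by lra.
pose S := order_slope_int alpha X.
have S_ge0 : 0 <= S by rewrite order_slope_int_ge0// ltW.
have slope_ge0 := Gamma_slope_ge0 alpha_gt0.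
have Gamma_gt := @Gamma_gt0 R alpha alpha_gt0.
have [m_gt0 /andP[m1_lt m_ge]] := nceil_itv alpha_gt0; rewrite -/m in m_gt0 m1_lt m_ge.
(* Raising the order by at most [gap] keeps it at most [m], or at most [m + 1] in
   case [alpha = m]; so at most one coefficient is added. *)
pose gap := if alpha < m%:R then m%:R - alpha else 1.
have gap_gt0 : 0 < gap by rewrite /gap; case: ifP => // ?; rewrite subr_gt0.
pose eps0 := Num.min (Num.min (Num.min 1 gap) (K / 2))
  (Num.min (kappa / (S + 1)) (Gamma alpha / 2 / (Gamma_slope alpha + 1))).
have eps0_gt0 : 0 < eps0.
  by rewrite !lt_min ltr01 gap_gt0 !divr_gt0//= ltr_wpDl.
have C_gt0 : 0 < 2 * (1 + M' * S) by rewrite mulr_gt0// ltr_wpDr// mulr_ge0.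
exists eps0, (X `^ rho^-1), (2 * (1 + M' * S)); split=> //; first exact: powR_gt0.
move=> alpha' b' alpha_lt bb' eps eps'; rewrite /eps0 !le_min.
move=> /andP[/andP[/andP[eps1 eps_gap] _] /andP[eps_S eps_G]].
move=> /andP[/andP[_ eps'K] _].
have eps_ge0 : 0 <= eps by rewrite subr_ge0 ltW.
have alpha'_gt0 : 0 < alpha' := lt_trans alpha_gt0 alpha_lt.
have alpha'E : alpha' = alpha + eps by rewrite /eps; ring.
have slope_le : eps * Gamma_slope alpha <= Gamma alpha / 2.
  rewrite mulrC; apply: le_trans (mul_frac_le slope_ge0 _); last by rewrite divr_ge0// ltW.
  exact: ler_wpM2l.
have eps_S_le : eps * S <= kappa.
  rewrite mulrC; apply: le_trans (mul_frac_le S_ge0 _); last exact: ltW.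
  exact: ler_wpM2l.
have kern_X' : kern (alpha' + 1) X <= 2 * kappa.
  rewrite alpha'E; apply: le_trans (kern_order_le _ alpha_gt0 _ slope_le) _.
    by rewrite eps_ge0.
  by rewrite mulr_natl mulr2n lerD.
have nceil_le : (nceil alpha' == m) || (nceil alpha' == m.+1).
  move: eps_gap; rewrite /gap; case: ltP => [am|am] eg; apply/orP; [left|right]; apply/eqP.
    apply: nceilP => //; rewrite (lt_trans m1_lt alpha_lt)/= alpha'E.
    by rewrite -lerBrDl.
  have aE : alpha = m%:R by apply/eqP; rewrite eq_le m_ge am.
  by apply: nceilP => //=; rewrite -aE alpha_lt/= -natr1 -aE alpha'E lerD2l.
have taylor_le x : 0 <= x <= X ->
    `|taylor b' (nceil alpha') x - taylor b m x| <= eps'.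
  by move=> /andP[x0 xX]; apply: taylor_dist => //; rewrite x0 (le_trans xX).
have LX : L * kern (alpha + 1) X <= 2^-1.
  by move: (ler_wpM2l L_ge0 kern_X) L_kappa; clear; lra.
have MX : M' * kern (alpha + 1) X <= K / 2.
  by move: (ler_wpM2l M'_ge0 kern_X) M_kappa K_gt0; clear; lra.
have LX' : L * kern (alpha' + 1) X <= 2^-1.
  by move: (ler_wpM2l L_ge0 kern_X') L_kappa; clear; lra.
have MX' : M' * kern (alpha' + 1) X <= K / 2.
  by move: (ler_wpM2l M'_ge0 kern_X') M_kappa; clear; lra.
have defined := clipped_solution_defined sigma_gt0 rho_gt0 K_gt0 hstar_gt0
  L_ge0 M_ge0 f_cont f_M f_L X_gt0 X_le.
split.
- apply: (defined _ _ alpha_gt0 LX MX) => x _; rewrite -/m subrr normr0.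
  by rewrite divr_ge0// ltW.
- apply: (defined _ _ alpha'_gt0 LX' MX') => x xX; apply: le_trans (taylor_le x xX) eps'K.
move=> psi phi psi_sol phi_sol; apply: ge_ereal_sup => _ [t th <-].
move: th; rewrite /= in_itv/= lee_fin => th.
have alpha'_itv : alpha <= alpha' <= alpha + 1.
  by rewrite ltW//= alpha'E lerD2l.
have S_max x : 0 <= x <= X -> order_slope_int alpha x <= S.
  by move=> /andP[_ xX]; exact: order_slope_int_homo.
apply: le_trans (clipped_solution_dist sigma_gt0 rho_gt0 K_gt0 hstar_gt0
  L_ge0 M_ge0 f_cont f_M f_L X_gt0 X_le alpha_gt0 erefl alpha'_itv slope_le S_max
  taylor_le LX psi_sol phi_sol th) _.
rewrite -/M' -/eps -[leRHS]mulrA ler_wpM2l//.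
have eps'_ge0 : 0 <= eps'.
  by apply: le_trans (taylor_le 0 _); rewrite ?lexx ?(ltW X_gt0).
rewrite [leRHS](_ : _ = eps' + M' * eps * S + (eps + M' * S * eps')); last by ring.
by rewrite lerDl addr_ge0// mulr_ge0// mulr_ge0.
Qed.
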